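(* For every $\rho\in[0,+\infty]$ there exists a $\mathbb{Z}^2$-action $(X,\mathbb{Z}^2,T)$ such that \begin{itemize} \item if $\vec v\in\{(-1,0),(1,0)\}$, then $\mathrm{mdim}(X,T,\langle\vec v\rangle^{\perp})=\rho$; \item if $\vec v\in\mathbb{S}\setminus\{(-1,0),(1,0)\}$, then $\mathrm{mdim}(X,T,\langle\vec v\rangle^{\perp})=0$. \end{itemize} In particular, if $\rho>0$, the function $\mathbb{S}\to[0,+\infty]$, $\vec v\mapsto \mathrm{mdim}(X,T,\langle\vec v\rangle^{\perp})$, is not continuous.
   Context: A $\mathbb{Z}^k$-action $(X,\mathbb{Z}^k,T)$ is a compact metric space $X$ together with a continuous map $T\colon\mathbb{Z}^k\times X\to X$, $(n,x)\mapsto T^nx$, with $T^0x=x$ and $T^{m+n}x=T^m(T^nx)$ for all $m,n\in\mathbb{Z}^k$ and $x\in X$. For a compact metric space $(X,d)$ and $\epsilon>0$, a continuous map $f\colon X\to Y$ is an $\epsilon$-embedding if $f(x)=f(x')$ implies $d(x,x')<\epsilon$. $\mathrm{Widim}_\epsilon(X,d)$ is the minimum of the topological dimensions $\dim K$ over all compact metric spaces $K$ admitting an $\epsilon$-embedding $X\to K$. For a finite $\Omega\subset\mathbb{Z}^k$, set $d^T_\Omega(x,x')=\max_{n\in\Omega}d(T^nx,T^nx')$. Write $[-N,N]^k$ for the integer cube $\{n\in\mathbb{Z}^k: -N\le n_i\le N \text{ for all } i\}$; when intersected with a real subspace it means the real cube. Fix $r>\sqrt{k}/2$. For a linear subspace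 $V\subseteq\mathbb{R}^k$ of dimension $h$, let $B_r(V)=\{u\in\mathbb{Z}^k: |u-w|<r \text{ for some } w\in V\}$. The $h$-dimensional directional mean dimension of $(X,\mathbb{Z}^k,T)$ with respect to $V$ is $$\mathrm{mdim}(X,T,V)=\lim_{\epsilon\to0}\ \liminf_{N\to\infty}\frac{\mathrm{Widim}_\epsilon\big(X,d^T_{B_r(V)\cap[-N,N]^k}\big)}{\mathrm{vol}_h\big(V\cap[-N,N]^k\big)},$$ where $\mathrm{vol}_h$ is $h$-dimensional volume in $V$ and $d$ is a compatible metric on $X$; this value is independent of $r>\sqrt{k}/2$ and of the compatible metric $d$. $\mathbb{S}=\{\vec v\in\mathbb{R}^2: |\vec v|=1\}$, and $\langle\vec v\rangle^{\perp}$ is the one-dimensional subspace of $\mathbb{R}^2$ orthogonal to $\vec v$. *)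

(* Defs.v *)
From HB Require Import structures.
From mathcomp Require Import all_boot all_order all_algebra.
From mathcomp Require Import all_classical all_reals all_analysis.
Set Implicit Arguments. Unset Strict Implicit. Unset Printing Implicit Defensive.
Import Order.TTheory GRing.Theory Num.Theory.
Import numFieldNormedType.Exports.
Local Open Scope classical_set_scope.
Local Open Scope ring_scope.

Definition compact_metric_space {R : realType} (K : pseudoMetricType R) : Prop :=
  hausdorff_space K /\ compact [set: K].

Definition compatible_metric {R : realType} (X : pseudoMetricType R)
  (d : X -> X -> R) : Prop :=
  (forall x y, 0 <= d x y) /\ (forall x y, d x y = 0 <-> x = y) /\
  (forall x y, d x y = d y x) /\ (forall x y z, d x z <= d x y + d y z) /\
  (forall (x : X) (A : set X),
      nbhs x A <-> exists2 e : R, 0 < e & [set y | d x y < e] `<=` A).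

Definition Z2_action {R : realType} (X : pseudoMetricType R)
  (T : int * int -> X -> X) : Prop :=
  (forall n, continuous (T n)) /\ (forall x, T (0, 0)%R x = x) /\
  (forall m n x, T (m.1 + n.1, m.2 + n.2)%R x = T m (T n x)).

Definition covdim_le {R : realType} (K : pseudoMetricType R) (n : nat) : Prop :=
  forall (I : finType) (U : I -> set K),
    (forall i, open (U i)) -> \bigcup_i U i = [set: K] ->
    exists (J : finType) (W : J -> set K),
      [/\ (forall j, open (W j)), \bigcup_j W j = [set: K],
          (forall j, exists i, W j `<=` U i) &
          (forall x, (#|[pred j : J | `[< W j x >]]| <= n.+1)%N)].

Definition eps_embedding {X Y : Type} {R : realType} (dist : X -> X -> R)
  (eps : R) (f : X -> Y) : Prop :=
  forall x x', f x = f x' -> dist x x' < eps.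

Definition Widim {R : realType} (X : pseudoMetricType R) (dist : X -> X -> R)
  (eps : R) : \bar R :=
  ereal_inf [set ((n%:R : R)%:E) | n in
    [set n : nat | exists (K : pseudoMetricType R) (f : X -> K),
       [/\ compact_metric_space K, continuous f, eps_embedding dist eps f &
           covdim_le K n]]].

Definition perp_line {R : realType} (v : R * R) : set (R * R) :=
  [set w | w.1 * v.1 + w.2 * v.2 = 0].

Definition Br {R : realType} (r : R) (V : set (R * R)) : set (int * int) :=
  [set u | exists2 w, V w &
     Num.sqrt ((u.1%:~R - w.1) ^+ 2 + (u.2%:~R - w.2) ^+ 2) < r].

(** d^T_Omega with Omega = P cap [-N,N]^2 (a max over a finite set;
    d >= 0 and 0 in Omega in our uses, so the default 0 is harmless). *)
Definition dT {R : realType} (X : Type) (d : X -> X -> R)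
  (T : int * int -> X -> X) (P : set (int * int)) (N : nat) (x y : X) : R :=
  \big[Num.max/0]_(i < (N + N).+1) \big[Num.max/0]_(j < (N + N).+1)
    (let n := ((i%:Z - N%:Z)%R, (j%:Z - N%:Z)%R) in
     if `[< P n >] then d (T n x) (T n y) else 0).

(** vol_1(V cap [-N,N]^2) for V = <v>^perp with |v| = 1: V is parametrised
    isometrically by t |-> t * (-v.2, v.1). *)
Definition vol_perp {R : realType} (v : R * R) (N : nat) : \bar R :=
  (@lebesgue_measure R) [set t : R | `|t * v.2| <= N%:R /\ `|t * v.1| <= N%:R].

(** One-dimensional directional mean dimension mdim(X, T, <v>^perp),
    for a given compatible metric d and a given r > sqrt 2 / 2. *)
Definition mdim_perp {R : realType} (X : pseudoMetricType R) (d : X -> X -> R)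
  (T : int * int -> X -> X) (r : R) (v : R * R) : \bar R :=
  lim ((fun eps : R =>
          limn_einf (fun N : nat =>
            (Widim (dT d T (Br r (perp_line v)) N) eps
             * ((fine (vol_perp v N))^-1)%:E)%E))
       @ (0 : R)^'+).

Definition unit_circle {R : realType} : set (R * R) :=
  [set v | v.1 ^+ 2 + v.2 ^+ 2 = 1].

(* Main.v *)
(* Let X be the set of [0,1]-valued configurations on Z^2 x N that are supported
   in a single vertical column, along a vertical translate of a pattern with
   floor((h+1) rho) - floor(h rho) sites at height h (every site, if rho is
   infinite); Z^2 acts by translations. The number of sites of the pattern on
   an interval of n heights differs from n rho by at most 1. A strip of length
   2N around the vertical axis therefore sees unions of cubes of dimension at
   most 2N rho + O(1), and contains a cube of dimension at least 2N rho - 1. A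
   strip around any other line meets each column in boundedly many sites, and
   sees only unions of cubes of bounded dimension.
   The upper bounds on Widim come from a truncation to finitely many sites,
   whose image is a union of cubes with an explicit cover of small order. The
   lower bounds come from Lebesgue's covering theorem for the cube, through
   Kuhn's cubical version of Sperner's lemma. *)
Require Import Defs.
From HB Require Import structures.
From mathcomp Require Import all_boot all_order all_algebra.
From mathcomp Require Import all_classical all_reals all_analysis.
From mathcomp Require Import zify ring lra.
Set Implicit Arguments. Unset Strict Implicit. Unset Printing Implicit Defensive.
Import Order.TTheory GRing.Theory Num.Theory.
Import numFieldNormedType.Exports.
Local Open Scope ring_scope.

(** * A cubical Sperner lemma *)

Lemma addF2 (x : 'F_2) : x + x = 0.
Proof. by case: x => [[|[|m]] hm]; apply/val_inj. Qed.

(** The terms for (i, j) and (j, i) agree, and cancel modulo 2. *)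
Lemma sum_sym_F2 (n : nat) (S : {set 'I_n}) (g : 'I_n -> 'I_n -> 'F_2) :
  (forall i j, g i j = g j i) ->
  \sum_(j in S) \sum_(i in S :\ j) g i j = 0.
Proof.
move=> gC.
pose a := \sum_(j in S) \sum_(i in S | (i < j)%N) g i j.
have -> : \sum_(j in S) \sum_(i in S :\ j) g i j =
  a + \sum_(j in S) \sum_(i in S | (j < i)%N) g i j.
  rewrite -big_split; apply: eq_bigr => j jS.
  rewrite (bigID (fun i : 'I_n => (i < j)%N)) /=; congr (_ + _);
    apply: eq_bigl => i; rewrite !inE -val_eqE /=; lia.
rewrite [X in _ + X](_ : _ = a) ?addF2 //.
rewrite (exchange_big_dep (mem S)) /= /a; last by move=> i j _ /andP[].
by apply: eq_bigr => i iS; apply: eq_big => [j|j _]; [rewrite iS|exact: gC].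
Qed.

Section CubicalSperner.
Variables (n M : nat).
Notation vertex := {ffun 'I_n -> 'I_M.+1}.
Variable lab : vertex -> 'I_n.+1.
Implicit Types (v w : vertex) (S : {set 'I_n}) (L : {set 'I_n.+1}).

Definition inc (i : 'I_n) v : vertex :=
  [ffun j => if j == i then inord (v j).+1 else v j].

Lemma inc_id i v : (v i < M)%N -> inc i v i = (v i).+1 :> nat.
Proof. by move=> h; rewrite ffunE eqxx inordK. Qed.

Lemma inc_neq i j v : j != i -> inc i v j = v j.
Proof. by move=> h; rewrite ffunE (negbTE h). Qed.

Lemma incC i j v : inc i (inc j v) = inc j (inc i v).
Proof.
apply/ffunP => k; rewrite !ffunE; case: (eqVneq k i) => [->|ki];
  by case: eqVneq => // ->.
Qed.

(* The number modulo 2 of monotone lattice paths from [v] that use each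
   direction of [S] once and whose k + 1 labels are those of [L]. *)
Fixpoint rainbow (k : nat) v S L : 'F_2 :=
  if k is k'.+1 then
    \sum_(i in S) (lab v \in L)%:R * rainbow k' (inc i v) (S :\ i) (L :\ lab v)
  else (L == [set lab v])%:R.

Arguments rainbow : simpl never.

Lemma rainbow0 v S L : rainbow 0 v S L = (L == [set lab v])%:R.
Proof. by []. Qed.

Lemma rainbowS k v S L : rainbow k.+1 v S L = \sum_(i in S)
  (lab v \in L)%:R * rainbow k (inc i v) (S :\ i) (L :\ lab v).
Proof. by []. Qed.

Lemma rainbowS_out k v S L : lab v \notin L -> rainbow k v S L = 0.
Proof.
move=> vL; case: k => [|k].
  by rewrite rainbow0; case: eqP vL => // ->; rewrite finset.set11.
by rewrite rainbowS big1 // => i _; rewrite (negbTE vL) mul0r.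
Qed.

Lemma rainbowS_in k v S L : lab v \in L ->
  rainbow k.+1 v S L = \sum_(i in S) rainbow k (inc i v) (S :\ i) (L :\ lab v).
Proof. by move=> vL; apply: eq_bigr => i _; rewrite vL mul1r. Qed.

Lemma rainbow_boundary_out k v S L : lab v \notin L ->
  \sum_(i in S) (rainbow k (inc i v) (S :\ i) L + rainbow k v (S :\ i) L) =
  \sum_(c | c \notin L) rainbow k.+1 v S (c |: L).
Proof.
move=> vL; rewrite [RHS](bigD1 (lab v)) //= [X in _ + X]big1 ?addr0; last first.
  move=> c /andP[_ cv]; rewrite rainbowS_out // !inE eq_sym negb_or cv.
  exact: vL.
rewrite rainbowS_in ?finset.setU11 // finset.setU1K //.
by apply: eq_bigr => i _; rewrite (rainbowS_out _ _ vL) addr0.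
Qed.

(* Both sides count, modulo 2, pairs of a path and one of its vertices such that
   the other vertices carry the labels L. If the chosen vertex is neither first
   nor last, exchanging the two adjacent steps gives another such pair; if its
   label is in L, the path has a second such vertex. *)
Lemma rainbow_boundary k v S L : #|S| = k.+1 -> #|L| = k.+1 ->
  \sum_(i in S) (rainbow k (inc i v) (S :\ i) L + rainbow k v (S :\ i) L) =
  \sum_(c | c \notin L) rainbow k.+1 v S (c |: L).
Proof.
elim: k v S L => [|k IH] v S L cS cL; have [vL|vL] := boolP (lab v \in L).
- move/eqP/cards1P: cL => [l lE]; move/eqP/cards1P: cS => [i ->].
  move: vL; rewrite lE inE => /eqP vl.
  rewrite big_set1 !rainbow0 vl eqxx !(inj_eq finset.set1_inj).
  under eq_bigr => c cl.
    rewrite rainbowS_in ?vl ?finset.setU11 ?inE ?eqxx ?orbT // big_set1 rainbow0.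
    rewrite finset.setUC finset.setU1K ?(inj_eq finset.set1_inj); last first.
      by rewrite inE; move: cl; rewrite inE eq_sym.
    over.
  rewrite (eq_bigl (fun c => c != l)); last by move=> c; rewrite inE.
  case: (eqVneq l (lab (inc i v))) => [<-|e].
    by rewrite big1 ?addF2 // => c /negbTE ->.
  rewrite (bigD1 (lab (inc i v))) 1?eq_sym //= eqxx big1 => [|c /andP[_ cl]].
    by rewrite addr0 add0r.
  by rewrite (negbTE cl).
- by exact: rainbow_boundary_out.
- rewrite big_split /=.
  pose b := lab v; have vLb : b \in L := vL.
  have ih j : j \in S ->
      \sum_(i in S :\ j) (rainbow k (inc i (inc j v)) (S :\ j :\ i) (L :\ b) +
        rainbow k (inc j v) (S :\ j :\ i) (L :\ b)) =
      rainbow k.+1 (inc j v) (S :\ j) L +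
      \sum_(c | c \notin L) rainbow k.+1 (inc j v) (S :\ j) ((c |: L) :\ b).
    move=> jS; rewrite IH; last 2 first.
    - by move: cS; rewrite (cardsD1 j) jS => -[].
    - by move: cL; rewrite (cardsD1 b) vL => -[].
    (* Adding back [b] restores [L]; every other admissible [c] lies outside [L]. *)
    rewrite (bigD1 b) ?inE ?eqxx //=; rewrite {1}/b (finset.setD1K vL).
    congr (_ + _); apply: eq_big => c.
      by rewrite !inE; case: (eqVneq c b) => [->|]; rewrite ?vLb ?andbT.
    rewrite !inE => /andP[] /[swap] cb; rewrite cb /= => _.
    congr rainbow; apply/finset.setP => x; rewrite !inE.
    by case: (eqVneq x b) => //= ->; rewrite eq_sym (negbTE cb).
  (* Exchanging the first two steps does not change the rest of the path, so these terms cancel in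
     pairs. *)
  have /eqP : \sum_(j in S) \sum_(i in S :\ j)
     rainbow k (inc i (inc j v)) (S :\ j :\ i) (L :\ b) = 0.
    by apply: sum_sym_F2 => i j; rewrite incC !finset.setDDl finset.setUC.
  rewrite -[X in X == 0](addrK (\sum_(j in S) \sum_(i in S :\ j)
     rainbow k (inc j v) (S :\ j :\ i) (L :\ b))).
  rewrite -big_split /=; under eq_bigr => j jS do rewrite -big_split (ih j jS).
  rewrite big_split /= subr_eq0 => /eqP E.
  rewrite [X in _ + X = _](_ : _ = \sum_(j in S) \sum_(i in S :\ j)
      rainbow k (inc j v) (S :\ j :\ i) (L :\ b)); last first.
    under eq_bigr do rewrite rainbowS_in //.
    rewrite (exchange_big_dep (mem S)) /=; last first.
      by move=> i j _; rewrite inE => /andP[].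
    apply: eq_bigr => j jS; apply: eq_big => [i|i _]; last first.
      by rewrite !finset.setDDl finset.setUC.
    by rewrite !inE jS eq_sym andbT andbC.
  rewrite -E exchange_big /= addrA addF2 add0r; apply: eq_bigr => c cL'.
  by rewrite rainbowS_in // inE vL orbT.
- exact: rainbow_boundary_out.
Qed.

(** A nonzero count modulo 2 forces a path to exist. Its vertices stay in the face at [v] spanned by
    the directions of [S], and carry every label of [L]. *)
Lemma rainbow_neq0 k v S L : (forall j, j \in S -> v j < M)%N ->
  rainbow k v S L != 0 -> forall l, l \in L ->
  exists2 u, lab u = l &
    forall j, (v j <= u j <= (v j).+1)%N /\ (j \notin S -> u j = v j).
Proof.
elim: k v S L => [|k IH] v S L vS.
  rewrite rainbow0; have [->|_] := eqVneq L [set lab v]; last by rewrite eqxx.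
  by move=> _ l; rewrite inE => /eqP ->; exists v => // j; rewrite leqnn leqnSn.
rewrite rainbowS => /eqP h l lL.
have [i iS] : exists2 i, i \in S &
    (lab v \in L)%:R * rainbow k (inc i v) (S :\ i) (L :\ lab v) != 0.
  have [i /andP[iS hi]|H] := pickP (fun i => (i \in S) &&
    ((lab v \in L)%:R * rainbow k (inc i v) (S :\ i) (L :\ lab v) != 0)).
    by exists i.
  case: h; apply: big1 => i iS; apply/eqP.
  by have := H i; rewrite iS /= => /negbFE.
have [vL|_] := boolP (lab v \in L); last by rewrite mul0r eqxx.
rewrite mul1r => /IH H.
case: (eqVneq l (lab v)) => [->|lv].
  by exists v => // j; rewrite leqnn leqnSn.
have vS' j : j \in S :\ i -> (inc i v j < M)%N.
  by rewrite inE => /andP[ji jS]; rewrite inc_neq; [exact: vS|move: ji; rewrite inE].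
have [|u ul uv] := H vS' l; first by rewrite !inE lv.
exists u => // j; have [h1 h2] := uv j.
case: (eqVneq j i) => [e|ji]; last first.
  move: h1 h2; rewrite inc_neq // => h1 h2; split => // jS; apply: h2.
  by rewrite inE (negbTE jS) andbF.
subst j; split; last by rewrite iS.
rewrite h2 ?inE ?eqxx // inc_id ?vS //; lia.
Qed.

Hypothesis M_gt0 : (0 < M)%N.

Definition in_box_but k (i : 'I_n) v := [forall j : 'I_n,
  (j != i) ==> (if (j < k)%N then (v j < M)%N else v j == 0%N :> nat)].

Definition in_box k v := [forall j : 'I_n,
  if (j < k)%N then (v j < M)%N else v j == 0%N :> nat].

Lemma in_box_butE k (i : 'I_n) v : (i < k)%N ->
  in_box k v = in_box_but k i v && (v i < M)%N.
Proof.
move=> ik; apply/forallP/andP => [h|[/forallP h vi] j].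
  split; last by have := h i; rewrite ik.
  by apply/forallP => j; rewrite h implybT.
case: (eqVneq j i) => [->|ji]; first by rewrite ik.
by have := h j; rewrite ji.
Qed.

Definition dec (i : 'I_n) v : vertex :=
  [ffun j => if j == i then inord (v j).-1 else v j].

Lemma in_box_but_inc k i v : in_box_but k i (inc i v) = in_box_but k i v.
Proof. by apply: eq_forallb => j; case: eqVneq => //= ji; rewrite inc_neq. Qed.

(** Along each line in direction [i], an inner vertex is counted twice, as [v] and as [inc i v];
    modulo 2 only the two ends remain. *)
Lemma sum_box_telescope k (i : 'I_n) (g : vertex -> 'F_2) : (i < k)%N ->
  \sum_(v | in_box k v) (g (inc i v) + g v) =
  \sum_(v | in_box_but k i v && (v i == M :> nat)) g v +
  \sum_(v | in_box_but k i v && (v i == 0%N :> nat)) g v.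
Proof.
move=> ik; rewrite big_split /=.
under eq_bigl do rewrite (in_box_butE _ ik).
under [X in _ + X = _]eq_bigl do rewrite (in_box_butE _ ik).
have -> : \sum_(v | in_box_but k i v && (v i < M)%N) g (inc i v) =
   \sum_(v | in_box_but k i v && (0 < v i)%N) g v.
  rewrite [RHS](reindex_onto (inc i) (dec i)) /=; last first.
    move=> v /andP[_ vi]; apply/ffunP => j; rewrite !ffunE.
    case: eqVneq => // ->; apply/val_inj.
    have := ltn_ord (v i); rewrite /= => h.
    by rewrite !inordK //; lia.
  apply: eq_bigl => v; rewrite in_box_but_inc -andbA; congr andb.
  have [vi|vi] := ltnP (v i) M; last first.
    (* When [v i] is [M], its successor is out of range and [inord] returns 0; both sides are then
       false. *)
    by rewrite ffunE eqxx /inord val_insubd; case: ifP => //=; lia.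
  rewrite inc_id //=; apply/esym/eqP/ffunP => j; rewrite !ffunE.
  case: eqVneq => // ->; apply/val_inj.
  by rewrite /= (@inordK _ (v i).+1) //= inordK.
rewrite (bigID (fun v : vertex => v i == M :> nat)) /=.
rewrite [X in _ + X = _](bigID (fun v : vertex => v i == 0%N :> nat)) /=.
rewrite addrACA [X in _ + X](_ : _ = 0); last first.
  rewrite -[RHS](addF2 (\sum_(v | in_box_but k i v && ((0 < v i < M)%N)) g v)).
  by congr (_ + _); apply: eq_bigl => v; rewrite -andbA; congr andb;
    move: (ltn_ord (v i)); move: (nat_of_ord (v i)) => x xM; case: eqP; lia.
rewrite addr0; congr (_ + _); apply: eq_bigl => v; rewrite -andbA; congr andb; lia.
Qed.

Hypothesis lab_le : forall v (i : 'I_n), v i = 0%N :> nat -> (lab v <= i)%N.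
Hypothesis lab_neq : forall v (i : 'I_n), v i = M :> nat -> lab v <> i :> nat.

Let dirs k := [set i : 'I_n | (i < k)%N].
Let labels k := [set l : 'I_n.+1 | (l < k)%N].

(** A path counted here never moves in direction [i], so it stays in a facet on which the label [l]
    does not occur. *)
Lemma rainbow_face k (i : 'I_n) v L (l : 'I_n.+1) : in_box_but k i v ->
  l \in L -> (forall u : vertex, u i = v i -> lab u != l) ->
  rainbow k.-1 v (dirs k :\ i) L = 0.
Proof.
move=> /forallP vb lL H; apply/eqP/negPn/negP => /rainbow_neq0 => /(_ _ _ lL) [].
  move=> j; rewrite !inE => /andP[ji jk].
  by have := vb j; rewrite ji jk.
move=> u ul /(_ i)[_ ui]; have := H u.
by rewrite ul eqxx ui ?inE ?eqxx // => /(_ erefl).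
Qed.

Lemma card_dirs k : (k <= n)%N -> #|dirs k| = k.
Proof.
move=> kn; rewrite cardsE -sum1_card (eq_bigl (fun i : 'I_n => (i < k)%N)) //.
by rewrite (big_ord_narrow kn) sum1_card card_ord.
Qed.

Lemma card_labels k : (k <= n.+1)%N -> #|labels k| = k.
Proof.
move=> kn; rewrite cardsE -sum1_card (eq_bigl (fun i : 'I_n.+1 => (i < k)%N)) //.
by rewrite (big_ord_narrow kn) sum1_card card_ord.
Qed.

(** Induction on [k]: [rainbow_boundary] rewrites the count in dimension k + 1 as a sum over facets
    of cells. Inner facets cancel, and each outer one misses a label at most [k], except the facet
    where coordinate [k] is 0, which is the face of the previous dimension. *)
Lemma sum_rainbow k : (k <= n)%N ->
  \sum_(v | in_box k v) rainbow k v (dirs k) (labels k.+1) = 1.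
Proof.
elim: k => [_|k IH kn].
  pose o : vertex := [ffun=> ord0].
  rewrite (big_pred1 o) => [|v]; last first.
    apply/forallP/eqP => [h|-> j]; last by rewrite ffunE.
    by apply/ffunP => j; rewrite ffunE; apply/val_inj/eqP; exact: h.
  rewrite rainbow0 (_ : _ == _) //; apply/eqP/finset.setP => l; rewrite !inE.
  have : lab o = 0%N :> nat; last by move=> e; rewrite -val_eqE /= e; lia.
  case: (posnP n) => [n0|n0].
    by have := ltn_ord (lab o); rewrite {2}n0; lia.
  have := @lab_le o (Ordinal n0); rewrite ffunE => /(_ erefl).
  by rewrite leqn0 => /eqP.
pose ik : 'I_n := Ordinal kn; pose L := labels k.+1.
have top : inord k.+1 \notin L by rewrite inE inordK ?ltnn.
(* The added terms are 0: coordinate k + 1 vanishes on this face, so by [lab_le] no label exceeds k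
   + 1. *)
have -> : \sum_(v | in_box k.+1 v) rainbow k.+1 v (dirs k.+1) (labels k.+2) =
    \sum_(v | in_box k.+1 v) \sum_(c | c \notin L)
       rainbow k.+1 v (dirs k.+1) (c |: L).
  apply: eq_bigr => v vb; rewrite (bigD1 (inord k.+1)) //= big1 ?addr0.
    congr rainbow; apply/finset.setP => l; rewrite !inE -val_eqE /= inordK //; lia.
  move=> c; rewrite inE -val_eqE /= inordK // => /andP[cL ck].
  have kn1 : (k.+1 < n)%N by have := ltn_ord c; lia.
  apply/eqP/negPn/negP => /rainbow_neq0 /(_ c (finset.setU11 _ _))[].
    by move=> j; rewrite inE => jk; move/forallP: vb => /(_ j); rewrite jk.
  move=> u uc /(_ (Ordinal kn1)) [_]; rewrite inE ltnn => /(_ isT) uv.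
  have := @lab_le u (Ordinal kn1); rewrite uc uv.
  move/forallP: vb => /(_ (Ordinal kn1)); rewrite ltnn => /eqP -> /(_ erefl) /=; lia.
have cd : #|dirs k.+1| = k.+1 by rewrite card_dirs.
have cl : #|L| = k.+1 by rewrite card_labels // ltnW.
under eq_bigr do rewrite -(rainbow_boundary _ cd cl).
rewrite exchange_big /=.
under eq_bigr => i idir.
  have ilt : (i < k.+1)%N by move: idir; rewrite inE.
  rewrite (@sum_box_telescope _ _ (fun v => rainbow k v (dirs k.+1 :\ i) L)) //.
  (* On the facet [v i = M] the label [i] is missing, by [lab_neq]. *)
  rewrite [X in X + _]big1 ?add0r; last first.
    move=> v /andP[vb /eqP vM].
    apply: (@rainbow_face k.+1 _ _ _ (widen_ord (leqnSn n) i)) => //.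
      by rewrite inE /=.
    by move=> u; rewrite -val_eqE /= => uv; apply/eqP/lab_neq; rewrite uv.
  over.
(* Where a coordinate [i < k] is 0, labels are at most [i], so [k] is missing. *)
rewrite (bigD1 ik) /= ?inE ?ltnS //= [X in _ + X]big1 ?addr0; last first.
  move=> i /andP[]; rewrite inE -val_eqE /= => ilt ik'.
  rewrite big1 // => v /andP[vb /eqP v0].
  apply: (@rainbow_face k.+1 _ _ _ (widen_ord (leqnSn n) ik)) => //.
    by rewrite inE /=.
  move=> u uv; rewrite -val_eqE /=.
  have := @lab_le u i; rewrite uv => /(_ v0); lia.
rewrite -[RHS]IH; last by lia.
apply: eq_big => v.
  apply/andP/forallP => [[/forallP vb vk] j|h].
    case: (eqVneq j ik) => [->|jk]; first by rewrite /= ltnn.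
    have := vb j; rewrite jk /= ltnS; move: jk; rewrite -val_eqE /=.
    by have [] := ltngtP (nat_of_ord j) k.
  split; last by have := h ik; rewrite /= ltnn.
  apply/forallP => j; apply/implyP; rewrite -val_eqE /= => jk.
  have := h j; rewrite ltnS; move: jk.
  by have [] := ltngtP (nat_of_ord j) k.
move=> _; congr rainbow; apply/finset.setP => j; rewrite !inE -val_eqE /=; lia.
Qed.

(* Kuhn's cubical form of Sperner's lemma *)
Lemma cubical_sperner : exists v : vertex, (forall i, (v i < M)%N) /\
  forall l, exists2 u, lab u = l & forall i, (v i <= u i <= (v i).+1)%N.
Proof.
have [v /andP[vb vr]|H] := pickP (fun v => in_box n v &&
    (rainbow n v (dirs n) (labels n.+1) != 0)); last first.
  have := sum_rainbow (leqnn n); rewrite big1 => [/eqP|v vb].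
    by rewrite eq_sym oner_eq0.
  by have := H v; rewrite vb /= => /negbFE /eqP.
have vM i : (v i < M)%N by move/forallP: vb => /(_ i); rewrite ltn_ord.
exists v; split => // l.
have lL : l \in labels n.+1 by rewrite inE.
have [j _|u ul uv] := rainbow_neq0 _ vr lL; first exact: vM.
by exists u => // i; have [] := uv i.
Qed.

End CubicalSperner.

Local Open Scope classical_set_scope.
Local Open Scope ring_scope.

(** * Spaces of configurations with restricted support *)

(** Only finite parts of the support are constrained: finitely many nonzero coordinates stay nonzero
    nearby, so the condition passes to limits and the space is compact. *)
Record pattern_space (R : realType) (S : countType) (F : seq S -> Prop) :=
  PatternPoint {
    pt :> S -> R;
    pt_itv : forall s, 0 <= pt s <= 1;
    pt_supp : forall E, uniq E -> (forall s, s \in E -> pt s != 0) -> F E }.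

Section PatternSpace.
Context (R : realType) (S : countType) (F : seq S -> Prop).
Local Notation X := (pattern_space R F).

HB.instance Definition _ := gen_eqMixin X.
HB.instance Definition _ := gen_choiceMixin X.

(* The weights (pickle s).+1 make this the product topology. *)
Definition pt_ball (x : X) (e : R) (y : X) : Prop :=
  forall s, `|x s - y s| < e * (pickle s).+1%:R.

Lemma pt_ball_center x (e : R) : 0 < e -> pt_ball x e x.
Proof. by move=> e0 s; rewrite subrr normr0 mulr_gt0. Qed.

Lemma pt_ball_sym x y (e : R) : pt_ball x e y -> pt_ball y e x.
Proof. by move=> xy s; rewrite distrC. Qed.

Lemma pt_ball_triangle x y z (e1 e2 : R) :
  pt_ball x e1 y -> pt_ball y e2 z -> pt_ball x (e1 + e2) z.
Proof.
move=> xy yz s; rewrite -(subrKA (y s)) mulrDl (le_lt_trans (ler_normD _ _))//.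
exact: ltrD.
Qed.

HB.instance Definition _ := hasNbhs.Build X (nbhs_ (entourage_ pt_ball)).
HB.instance Definition _ := @Nbhs_isPseudoMetric.Build R X
  (entourage_ pt_ball) erefl pt_ball pt_ball_center pt_ball_sym
  pt_ball_triangle erefl.

Lemma pt_ballE : @ball R X = pt_ball. Proof. by []. Qed.

Lemma pt_ext (x y : X) : pt x =1 pt y -> x = y.
Proof.
case: x y => [x xi xs] [y yi ys] /= /funext xy.
by subst y; congr PatternPoint; exact: Prop_irrelevance.
Qed.

Lemma dist_pt (x y : X) s : `|x s - y s| <= 1.
Proof. have := pt_itv x s; have := pt_itv y s; rewrite ler_norml; lra. Qed.

(** Coordinates lie in [0, 1], so a site with [pickle s] above 1/e puts no constraint on the
    ball. *)
Lemma ball_window (e : R) : 0 < e -> exists B : seq S, forall x y : X,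
  (forall s, s \in B -> `|x s - y s| < e) -> ball x e y.
Proof.
rewrite pt_ballE.
move=> e0; set m := Num.truncn e^-1.
exists (pmap unpickle (iota 0 m.+1)) => x y xy s.
have [sm|sm] := ltnP (pickle s) m.+1.
  have /xy h : s \in pmap unpickle (iota 0 m.+1).
    by rewrite mem_pmap -[Some s]pickleK map_f // mem_iota.
  by rewrite (lt_le_trans h)// ler_peMr ?ler1n// ltW.
rewrite (le_lt_trans (dist_pt x y s))// -ltr_pdivrMl// mulr1.
by rewrite (lt_le_trans (truncnS_gt _))// ler_nat ltnW.
Qed.

Lemma filter_forall_in T (G : set_system T) (P : S -> set T) (B : seq S) :
  Filter G -> (forall s, s \in B -> G (P s)) ->
  G [set t | forall s, s \in B -> P s t].
Proof.
move=> FG; elim: B => [|s B IH] H; first by apply: filterS filterT.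
have /IH GB : forall s, s \in B -> G (P s).
  by move=> t tB; apply: H; rewrite inE tB orbT.
have := H s (mem_head _ _); apply: filterS2 GB => t tB ts u.
by rewrite inE => /predU1P[->|/tB].
Qed.

Lemma continuous_pt (s : S) : continuous (fun x : X => x s).
Proof.
move=> x; apply/(@cvgrPdist_lt _ _ _ (nbhs x) (nbhs_filter x)) => e e0.
have e0' : 0 < e / (pickle s).+1%:R by rewrite divr_gt0.
apply/nbhs_ballP; exists (e / (pickle s).+1%:R) => // y; rewrite pt_ballE => /(_ s).
by rewrite divfK.
Qed.

Lemma cvg_to_pt (T : Type) (G : set_system T) (f : T -> X) (x : X) :
  Filter G -> (forall s, (fun t => f t s) @ G --> x s) -> f @ G --> x.
Proof.
move=> FG fx A Ax; have /nbhs_ballP[e /= e0 eA] := Ax.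
have [B HB] := ball_window e0.
have GB s : s \in B -> G [set t | `|x s - f t s| < e].
  by move=> _; have /cvgrPdist_lt := fx s; apply.
suff : G (f @^-1` A) by []; apply: filterS (filter_forall_in FG GB) => t tB.
by apply: eA; apply: HB.
Qed.

Lemma continuous_to_pt (T : topologicalType) (f : T -> X) :
  (forall s, continuous (fun t => f t s)) -> continuous f.
Proof. by move=> fc t; apply: cvg_to_pt => s; exact: fc. Qed.

Lemma pattern_space_hausdorff : hausdorff_space X.
Proof.
rewrite ball_hausdorff pt_ballE => x y /eqP xy.
have [s xs] : exists s, x s <> y s.
  by apply/existsNP => h; apply: xy; exact: pt_ext.
have a0 : 0 < `|x s - y s| / (2 * (pickle s).+1%:R).
  by rewrite divr_gt0 ?mulr_gt0// normr_gt0 subr_eq0; exact/eqP.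
exists (PosNum a0, PosNum a0) => /=; apply/eqP/seteqP; split => // z.
move=> [/(_ s) xz /(_ s) yz].
have := ler_distD (z s) (x s) (y s); rewrite (distrC (z s)); apply/negP; rewrite -ltNge.
rewrite [ltRHS](_ : _ = `|x s - y s| / (2 * (pickle s).+1%:R) * (pickle s).+1%:R
   + `|x s - y s| / (2 * (pickle s).+1%:R) * (pickle s).+1%:R); last by field.
exact: ltrD.
Qed.

Lemma pattern_space_compact : compact [set: X].
Proof.
rewrite compact_ultra => G UG _; have FG : Filter G by exact: filter_filter.
have H s : exists c : R, 0 <= c <= 1 /\ (fun x : X => x s) @ G --> c.
  have [|c [c01 cc]] := @segment_compact R 0 1 ((fun x : X => x s) @ G) _.
    suff : G [set x : X | (x s) \in `[0, 1]] by [].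
    by apply: filterS filterT => x _; rewrite /= in_itv /=; exact: pt_itv.
  exists c; split; first by move: c01; rewrite /= in_itv.
  move=> A cA; have [//|GA] := in_ultra_setVsetC [set x : X | A (x s)] UG.
  by have [z [] //] := cc (~` A) A GA cA.
have [c Hc] := choice H.
(* The coordinates in [E], nonzero in the limit, are all nonzero at one common point of the space,
   which gives [F E]. *)
have cF E : uniq E -> (forall s, s \in E -> c s != 0) -> F E.
  move=> uE cE.
  have GE s : s \in E -> G [set x : X | x s != 0].
    move=> sE; have [_ /cvgrPdist_lt/(_ `|c s|)] := Hc s.
    rewrite normr_gt0 => /(_ (cE s sE)).
    by apply: filterS => x; apply: contraTneq => ->; rewrite subr0 ltxx.
  have /filter_ex[x xE] := filter_forall_in FG GE.
  exact: pt_supp uE xE.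
exists (PatternPoint (fun s => (Hc s).1) cF); split => //=.
by apply: (@cvg_to_pt _ G id) => s; exact: (Hc s).2.
Qed.

End PatternSpace.

(** * Covering dimension of unions of cubes *)

(** Compactness, as near coverings, makes a locally valid radius uniform. This serves for Lebesgue
    numbers and for comparing metrics. *)
Lemma uniform_radius (R : realType) (X : topologicalType) (P : R -> X -> Prop) :
  compact [set: X] ->
  (forall x : X, exists2 A : set X, nbhs x A & exists2 e : R, 0 < e &
     forall y t, A y -> 0 < t -> t < e -> P t y) ->
  exists2 t : R, 0 < t & forall x, P t x.
Proof.
move=> /compact_near_coveringP cX H.
have /filter_ex[t [t0 Ht]] : \forall t \near (0 : R)^'+, 0 < t /\ forall x, P t x.
  suff K : \forall t \near (0 : R)^'+, [set: X] `<=` P t.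
    by apply: filterS2 (nbhs_right_gt (0 : R)) K => t t0 Ht; split => // x; exact: Ht.
  apply: cX => x _; have [A Ax [e e0 He]] := H x.
  exists (A, [set t : R | 0 < t < e]) => /=.
    split => //; near=> t; apply/andP; split; near: t; first exact: nbhs_right_gt.
    exact: nbhs_right_lt.
  by move=> [y t] /= [Ay /andP[t0 te]]; exact: He.
by exists t.
Unshelve. all: by end_near.
Qed.

Lemma lebesgue_number (R : realType) (K : pseudoMetricType R) (I : Type)
    (U : I -> set K) : compact [set: K] -> (forall i, open (U i)) ->
    \bigcup_i U i = [set: K] ->
  exists2 e : R, 0 < e & forall x, exists i, ball x e `<=` U i.
Proof.
move=> cK Uo Uc.
apply: uniform_radius => // x.
have [i _ Uix] : (\bigcup_i U i) x by rewrite Uc.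
have /nbhs_ballP[e /= e0 xe] : nbhs x (U i) by exact: open_nbhs_nbhs.
exists (ball x (e / 2)); first by apply: nbhsx_ballx; rewrite divr_gt0.
exists (e / 2); rewrite ?divr_gt0// => y t xy t0 te; exists i => z yz; apply: xe.
by rewrite [e]splitr; apply: ball_triangle xy _; apply: le_ball yz; exact: ltW.
Qed.

(** These are finitely many strict inequalities between continuous functions. *)
Lemma open_star_conditions (R : realType) (T : topologicalType) (I : finType)
    (m : nat) (z : I -> T -> R) (J : {set I}) (c : I -> nat) :
  (forall s, continuous (z s)) ->
  open [set x |
    (forall s, s \in J -> (c s)%:R < m%:R * z s x < (c s)%:R + 1) /\
    (forall s, s \notin J -> `|m%:R * z s x - (c s)%:R| < 2^-1) /\
    (forall s s', s \in J -> s' \notin J ->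
      `|m%:R * z s' x - (c s')%:R| < m%:R * z s x - (c s)%:R /\
      `|m%:R * z s' x - (c s')%:R| < (c s)%:R + 1 - m%:R * z s x)].
Proof.
move=> cz; pose g s (x : T) : R := m%:R * z s x - (c s)%:R.
have cg s : continuous (g s).
  move=> x; rewrite /g; apply: cvgB; last exact: cvg_cst.
  by apply: cvgM; [exact: cvg_cst|exact: cz].
have pos (f : T -> R) x : continuous f -> 0 < f x -> \forall y \near x, 0 < f y.
  by move=> cf fx; exact: (@cvgr_gt R T (nbhs x) (nbhs_filter x) f (f x) (cf x) 0 fx).
rewrite openE => x [h1 [h2 h3]]; rewrite /interior.
have n1 : \forall y \near x, forall s : I, s \in J ->
    (c s)%:R < m%:R * z s y < (c s)%:R + 1.
  apply: filter_forall => s.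
  have [sp|sp] := boolP (s \in J); last exact: nearW.
  have /andP[a b] := h1 s sp.
  have a' : 0 < g s x by rewrite subr_gt0.
  have b' : 0 < (1 - g s x) by rewrite /g; lra.
  have cb : continuous (fun y => 1 - g s y).
    by move=> y; apply: cvgB; [exact: cvg_cst|exact: cg].
  by apply: filterS2 (pos _ _ (cg s) a') (pos _ _ cb b') => y; rewrite /g; lra.
have n2 : \forall y \near x, forall s : I, s \notin J ->
    `|m%:R * z s y - (c s)%:R| < 2^-1.
  apply: filter_forall => s.
  have [sp|sp] := boolP (s \in J); first exact: nearW.
  have a' : 0 < 2^-1 - `|g s x| by rewrite subr_gt0; exact: h2.
  have ca : continuous (fun y => 2^-1 - `|g s y|).
    by move=> y; apply: cvgB; [exact: cvg_cst|apply: cvg_norm; exact: cg].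
  by apply: filterS (pos _ _ ca a') => y; rewrite /g subr_gt0.
have n3 : \forall y \near x, forall s s' : I, s \in J -> s' \notin J ->
    `|m%:R * z s' y - (c s')%:R| < m%:R * z s y - (c s)%:R /\
    `|m%:R * z s' y - (c s')%:R| < (c s)%:R + 1 - m%:R * z s y.
  apply: filter_forall => s; apply: filter_forall => s'.
  have [sp|sp] := boolP (s \in J); last exact: nearW.
  have [sp'|sp'] := boolP (s' \in J); first exact: nearW.
  have [a b] := h3 s s' sp sp'.
  have a' : 0 < g s x - `|g s' x| by rewrite subr_gt0.
  have b' : 0 < 1 - g s x - `|g s' x| by rewrite subr_gt0 /g; lra.
  have cn : continuous (fun y => `|g s' y|).
    by move=> y; apply: cvg_norm; exact: cg.
  have ca : continuous (fun y => g s y - `|g s' y|).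
    by move=> y; apply: cvgB; [exact: cg|exact: cn].
  have cb : continuous (fun y => 1 - g s y - `|g s' y|).
    move=> y; apply: cvgB; last exact: cn.
    by apply: cvgB; [exact: cvg_cst|exact: cg].
  apply: filterS2 (pos _ _ ca a') (pos _ _ cb b') => y.
  by rewrite /g !subr_gt0 => ? ? _ _; split=> //; lra.
by apply: filterS3 n1 n2 n3 => y; split.
Qed.

Section CubeUnion.
Context (R : realType) (S : countType) (F : seq S -> Prop) (B : seq S) (k : nat).
Local Notation X := (pattern_space R F).
Hypothesis FB : forall E, uniq E -> F E -> {subset E <= B} /\ (size E <= k)%N.

Lemma pt_out (x : X) s : s \notin B -> x s = 0.
Proof.
move=> sB; apply: contraNeq sB => xs.
have /FB [] : F [:: s] by apply: (@pt_supp _ _ _ x) => // t; rewrite inE => /eqP ->.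
  by [].
by move=> + _; apply; rewrite inE.
Qed.

Lemma ball_cube_union (x y : X) (e : R) : 0 < e ->
  (forall s, s \in B -> `|x s - y s| < e) -> ball x e y.
Proof.
rewrite pt_ballE => e0 xy s; have [sB|sB] := boolP (s \in B).
  by rewrite (lt_le_trans (xy s sB))// ler_peMr ?ler1n// ltW.
by rewrite !pt_out// subrr normr0 mulr_gt0.
Qed.

Variable m : nat.
Hypothesis m_gt0 : (0 < m)%N.
Local Notation T := (seq_sub B).
Local Notation cell := ({set T} * {ffun T -> 'I_m.+1})%type.

(* The barycentric star, in the cubical grid of mesh 1/m, of the open cell with
   free directions J and base vertex c: coordinates in J are farther from the
   grid than those outside J. The sets J whose star contains a given point form
   a chain, whence the bound on the order of this cover. *)
Definition star (p : cell) : set X := [set x |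
  (forall s : T, s \in p.1 ->
     (p.2 s)%:R < m%:R * x (ssval s) < (p.2 s)%:R + 1) /\
  (forall s : T, s \notin p.1 -> `|m%:R * x (ssval s) - (p.2 s)%:R| < 2^-1) /\
  (forall s s' : T, s \in p.1 -> s' \notin p.1 ->
     `|m%:R * x (ssval s') - (p.2 s')%:R| < m%:R * x (ssval s) - (p.2 s)%:R /\
     `|m%:R * x (ssval s') - (p.2 s')%:R| < (p.2 s)%:R + 1 - m%:R * x (ssval s))].

Lemma star_open p : open (star p).
Proof. exact: open_star_conditions (fun s => @continuous_pt _ _ F (ssval s)). Qed.

Lemma nat_grid (a b : nat) (z : R) : a%:R < z < a%:R + 1 ->
  z - a%:R <= `|z - b%:R| \/ a%:R + 1 - z <= `|z - b%:R|.
Proof.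
move=> /andP[az za]; have [ab|ab] := leqP b a.
  left; have : b%:R <= a%:R :> R by rewrite ler_nat.
  by move=> ba; rewrite ger0_norm; lra.
right; have : a.+1%:R <= b%:R :> R by rewrite ler_nat.
by rewrite -addn1 natrD => ab'; rewrite ltr0_norm; lra.
Qed.

(** If [s] were free only in [p] and [s'] only in [q], each of the two coordinates would be strictly
    farther from the grid than the other. *)
Lemma star_sub p q x : star p x -> star q x -> p.1 \subset q.1 \/ q.1 \subset p.1.
Proof.
move=> [p1 [p2 p3]] [q1 [q2 q3]].
have [|/subsetPn[s sp sq]] := boolP (p.1 \subset q.1); first by left.
have [|/subsetPn[s' s'q s'p]] := boolP (q.1 \subset p.1); first by right.
have [h1 h2] := p3 s s' sp s'p; have [h3 h4] := q3 s' s s'q sq.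
have [] := nat_grid (q.2 s) (p1 s sp); have [] := nat_grid (p.2 s') (q1 s' s'q).
all: lra.
Qed.

Lemma nat_near (a b : nat) (z : R) : `|z - a%:R| < 2^-1 -> `|z - b%:R| < 2^-1 -> a = b.
Proof.
rewrite !ltr_distl => ha hb.
have ab : (a < b.+1)%N by rewrite -(ltr_nat R) -addn1 natrD; lra.
have ba : (b < a.+1)%N by rewrite -(ltr_nat R) -addn1 natrD; lra.
lia.
Qed.

Lemma nat_between (a b : nat) (z : R) : a%:R < z < a%:R + 1 ->
  b%:R < z < b%:R + 1 -> a = b.
Proof.
move=> ha hb.
have ab : (a < b.+1)%N by rewrite -(ltr_nat R) -addn1 natrD; lra.
have ba : (b < a.+1)%N by rewrite -(ltr_nat R) -addn1 natrD; lra.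
lia.
Qed.

(** By [star_sub], equal cardinalities give equal free directions. The base vertex is then the floor
    of the free coordinates and the nearest integer of the others. *)
Lemma star_inj p q x : star p x -> star q x -> #|p.1| = #|q.1| -> p = q.
Proof.
move=> px qx pq.
have e1 : p.1 = q.1.
  have [h|h] := star_sub px qx; apply/eqP; first by rewrite eqEcard h pq /=.
  by rewrite eq_sym eqEcard h pq /=.
have [p1 [p2 _]] := px; have [q1 [q2 _]] := qx.
rewrite (surjective_pairing p) (surjective_pairing q) e1; congr pair.
apply/ffunP => s; apply/val_inj => /=.
have [sq|sq] := boolP (s \in q.1).
  by apply: (nat_between (p1 s _) (q1 s sq)); rewrite e1.
by apply: (nat_near (p2 s _) (q2 s sq)); rewrite e1.
Qed.

(** Free coordinates are positive, so they belong to the support of [x]. *)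
Lemma star_card p x : star p x -> (#|p.1| <= k)%N.
Proof.
move=> [p1 _].
have uE : uniq [seq ssval s | s in p.1].
  by rewrite map_inj_uniq ?enum_uniq//; exact: val_inj.
have nz t : t \in [seq ssval s | s in p.1] -> x t != 0.
  move=> /mapP[s]; rewrite mem_enum => /p1 /andP[h _] ->.
  rewrite gt_eqF// -(pmulr_rgt0 _ (x := m%:R)) ?ltr0n//.
  exact: le_lt_trans h.
by have [_] := FB uE (pt_supp uE nz); rewrite size_map -cardE.
Qed.

Lemma star_close p x y : star p x -> star p y ->
  forall s, s \in B -> `|x s - y s| < m%:R^-1.
Proof.
move=> [x1 [x2 _]] [y1 [y2 _]] s sB; pose t : T := SeqSub sB.
rewrite -(ltr_pM2l (x := m%:R)) ?ltr0n// mulfV ?pnatr_eq0 -?lt0n//.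
rewrite -[X in X * _]ger0_norm// -normrM mulrBr.
have [tp|tp] := boolP (t \in p.1).
  by have := x1 t tp; have := y1 t tp; rewrite ltr_norml /=; lra.
by have := x2 t tp; have := y2 t tp; rewrite /= !ltr_norml; lra.
Qed.

Lemma star_cover x : exists p, star p x.
Proof.
pose z (s : T) := m%:R * x (ssval s).
have z0 s : 0 <= z s by rewrite mulr_ge0//; case/andP: (pt_itv x (ssval s)).
have zm s : z s <= m%:R by rewrite ler_piMr//; case/andP: (pt_itv x (ssval s)).
pose a s := Num.truncn (z s).
have az s : (a s)%:R <= z s < (a s)%:R + 1.
  by rewrite natr1; exact: truncn_itv.
have am s : (a s <= m)%N.
  by rewrite -(ler_nat R) (le_trans _ (zm s))//; case/andP: (az s).
(* Free directions are those at distance at least 1/4 from the grid; the other coordinates are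
   rounded to the nearest integer. *)
pose J := [set s | 4^-1 <= z s - (a s)%:R <= 3 / 4]%SET.
pose c s := if (s \notin J) && (2^-1 < z s - (a s)%:R) then (a s).+1 else a s.
have cm s : (c s < m.+1)%N.
  rewrite /c inE; case: ifPn => [|_]; last by rewrite ltnS.
  move=> /andP[_ h]; rewrite ltnS ltn_neqAle am andbT; apply/eqP => e.
  by have := zm s; rewrite -[in leRHS]e => h'; lra.
have cJ s : s \in J -> (c s)%:R = (a s)%:R :> R by rewrite /c => ->.
have cn s : s \notin J -> `|z s - (c s)%:R| < 4^-1.
  rewrite /c => sJ; rewrite sJ /=; move: sJ (az s).
  rewrite inE negb_and -!ltNge => /orP sJ.
  case: ifPn; rewrite -?leNgt => h1 h2; rewrite -?(natr1 R (a s)) ltr_norml;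
    case: sJ => h3; lra.
exists (J, [ffun s => Ordinal (cm s)]); split; [|split] => /=.
- move=> s sJ; rewrite ffunE /= -/(z s) cJ//.
  by move: sJ; rewrite inE; lra.
- by move=> s /cn; rewrite ffunE /= -/(z s); move/lt_trans; apply; lra.
- move=> s s' sJ /cn; rewrite !ffunE /= -/(z s) -/(z s') (cJ s sJ).
  by move: sJ; rewrite inE => sJ h; split; apply: (lt_le_trans h); lra.
Qed.

End CubeUnion.

(** Stars of mesh 1/m refine an open cover once 1/m is at most its Lebesgue number. By [star_inj] a
    point lies in at most one star for each number of free directions from 0 to [k]. *)
Lemma covdim_cube_union (R : realType) (S : countType) (F : seq S -> Prop)
    (B : seq S) (k : nat) :
  (forall E, uniq E -> F E -> {subset E <= B} /\ (size E <= k)%N) ->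
  covdim_le (pattern_space R F) k.
Proof.
move=> FB I U Uo Uc.
(* The empty space has the empty cover. Otherwise [x0] provides some [U i] to contain the empty
   stars. *)
have [|X0] := pselect (exists x : pattern_space R F, True); last first.
  exists 'I_0, (fun=> set0); split; [by case| |by case|by move=> x; case: X0; exists x].
  by apply/seteqP; split => // x; case: X0; exists x.
move=> [x0 _].
have [e e0 He] := lebesgue_number (@pattern_space_compact _ _ _) Uo Uc.
pose m := (Num.truncn e^-1).+1.
have me : m%:R^-1 <= e.
  by rewrite -[leRHS]invrK lef_pV2 ?posrE ?invr_gt0//; exact/ltW/truncnS_gt.
exists ({set seq_sub B} * {ffun seq_sub B -> 'I_m.+1})%type, (@star R S F B m); split.
- by move=> p; exact: star_open.
- apply/seteqP; split; first by [].
  by move=> x _; have [p xp] := star_cover B m x; exists p.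
- move=> p; have [[x px]|np] := pselect (@star R S F B m p !=set0); last first.
    by have [i _] := He x0; exists i => y py; case: np; exists y.
  have [i xi] := He x; exists i => y py; apply: xi.
  apply: (ball_cube_union FB e0) => s sB.
  by apply: lt_le_trans me; apply: (star_close _ px py).
- move=> x.
  have fk p : @star R S F B m p x -> (#|p.1| < k.+1)%N.
    by move=> px; rewrite ltnS; exact: (star_card FB _ px).
  pose f (p : {set seq_sub B} * {ffun seq_sub B -> 'I_m.+1}) : 'I_k.+1 := inord #|p.1|.
  rewrite -(card_ord k.+1).
  have finj : {in [pred p | `[< @star R S F B m p x >]] &, injective f}.
    move=> p q /[!inE] px qx /(congr1 val) /=.
    by rewrite !inordK ?fk//; exact: (star_inj _ px qx).
  by rewrite -(card_in_imset finj) max_card.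
Qed.

(** * Lebesgue's covering theorem *)

Lemma open_forall_fin (T : topologicalType) (I : finType) (A : I -> set T) :
  (forall i, open (A i)) -> open [set x | forall i, A i x].
Proof.
move=> Ao; rewrite openE => x Ax.
apply: (@filter_forall _ _ A (nbhs x) (nbhs_filter x)) => i.
exact: open_nbhs_nbhs.
Qed.

Lemma closed_image (X K : topologicalType) (f : X -> K) (A : set X) :
  compact [set: X] -> hausdorff_space K -> continuous f -> closed A ->
  closed (f @` A).
Proof.
move=> cX hK cf clA; apply: compact_closed => //.
apply: continuous_compact; first exact: continuous_subspaceT.
by rewrite -[A]setTI; exact: compact_closedI.
Qed.

(* [A0 i] and [A1 i] contain opposite faces of a cube in [X], and [g M] is the
   cube sampled on the grid of mesh 1/M. A member of a fine cover is coloured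
   by the first [i] such that it meets [A0 i] on the grid. *)
Lemma covdim_cube (R : realType) (X K : pseudoMetricType R) (f : X -> K)
    (n k : nat) (A0 A1 : 'I_n -> set X)
    (g : forall M, {ffun 'I_n -> 'I_M.+1} -> X) :
  compact [set: X] -> compact_metric_space K -> continuous f ->
  (forall i, closed (A0 i)) -> (forall i, closed (A1 i)) ->
  (forall i x y, A0 i x -> A1 i y -> f x <> f y) ->
  (forall M (v : {ffun 'I_n -> 'I_M.+1}) i, v i = 0%N :> nat -> A0 i (g M v)) ->
  (forall M (v : {ffun 'I_n -> 'I_M.+1}) i,
     (0 < M)%N -> v i = M :> nat -> A1 i (g M v)) ->
  (forall e : R, 0 < e -> exists2 M, (0 < M)%N & forall v u : {ffun 'I_n -> 'I_M.+1},
     (forall i, (v i <= u i <= (v i).+1)%N) -> ball (g M v) e (g M u)) ->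
  covdim_le K k -> (n <= k)%N.
Proof.
move=> cX [hK cK] cf cA0 cA1 sep gA0 gA1 gc.
(* [c i] selects which of the two images in direction [i] is avoided, so no member of a refinement
   meets both. *)
pose U (c : {ffun 'I_n -> bool}) : set K :=
  [set y | forall i, (~` (f @` (if c i then A1 i else A0 i))) y].
have Uo c : open (U c).
  by apply: open_forall_fin => i; apply/closed_openC/closed_image => //; case: (c i).
have Uc : \bigcup_c U c = [set: K].
  apply/seteqP; split => // y _.
  exists [ffun i => `[< (f @` A0 i) y >]] => // i; rewrite ffunE.
  case: asboolP => //= -[x xA <-] [x' x'A xx'].
  by apply: (sep i x x') => //; rewrite xx'.
move=> /(_ _ U Uo Uc)[J [W [Wo Wc WU Wk]]].
have Vo j : open (f @^-1` W j).
  by apply: open_comp => // x _; exact: cf.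
have Vc : \bigcup_j (f @^-1` W j) = [set: X].
  by rewrite -preimage_bigcup Wc preimage_setT.
have [e e0 He] := lebesgue_number cX Vo Vc.
have [M M0 gM] := gc e e0.
have [jv Hjv] := choice (fun v => He (g M v)).
(* The default colour [n] is for members that contain no image of a grid point with a zero
   coordinate. *)
pose P j (m : nat) := (m == n) || `[< exists i : 'I_n, i = m :> nat /\
   exists2 u : {ffun 'I_n -> 'I_M.+1}, u i = 0%N :> nat & W j (f (g M u)) >].
have exP j : exists m, P j m by exists n; rewrite /P eqxx.
have color_lt j : (ex_minn (exP j) < n.+1)%N.
  by case: ex_minnP => m _ /(_ n); rewrite /P eqxx; apply.
pose color j := Ordinal (color_lt j).
have Wv v : W (jv v) (f (g M v)) by apply: (Hjv v); exact: ballxx.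
have lab_le (v : {ffun 'I_n -> 'I_M.+1}) (i : 'I_n) :
    v i = 0%N :> nat -> (color (jv v) <= i)%N.
  move=> vi; rewrite /color /=; case: ex_minnP => m _; apply.
  by apply/orP; right; apply/asboolP; exists i; split => //; exists v.
have lab_neq (v : {ffun 'I_n -> 'I_M.+1}) (i : 'I_n) :
    v i = M :> nat -> color (jv v) <> i :> nat.
  move=> vi; rewrite /color /=; case: ex_minnP => m + _ mi; rewrite /P mi.
  rewrite ltn_eqF//= => /asboolP[i' [/val_inj -> [u ui Wu]]].
  have [c Wc'] := WU (jv v); have := Wc' _ Wu i; have := Wc' _ (Wv v) i.
  case: (c i) => [h _|_ h]; apply: h; last by exists (g M u) => //; exact: gA0.
  by exists (g M v) => //; exact: gA1.
have [v [_ Hv]] := cubical_sperner M0 lab_le lab_neq.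
(* Some cell has all n + 1 colours, and by the choice of [M] the image of its base point lies in a
   member of each colour. These members are distinct, so n + 1 is at most k + 1. *)
have Hl l : exists u, color (jv u) = l /\ W (jv u) (f (g M v)).
  have [u ul uv] := Hv l; exists u; split => //.
  by apply: (Hjv u); apply: ball_sym; exact: gM.
have [u Hu] := choice Hl.
rewrite -(leq_add2r 1) !addn1; apply: leq_trans (Wk (f (g M v))).
rewrite -[n.+1]card_ord; have uinj : injective (fun l => jv (u l)).
  by move=> l l' ll'; rewrite -(Hu l).1 -(Hu l').1 ll'.
rewrite -(card_codom uinj); apply/subset_leq_card/fintype.subsetP => j /codomP[l ->].
by rewrite inE; exact: (Hu l).2.
Qed.

(** An [eps]-embedding cannot identify points of opposite faces, so [covdim_cube] applies to each
    target space. *)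
Lemma Widim_ge_cube (R : realType) (X : pseudoMetricType R) (dist : X -> X -> R)
    (eps : R) (n : nat) (A0 A1 : 'I_n -> set X)
    (g : forall M, {ffun 'I_n -> 'I_M.+1} -> X) :
  compact [set: X] ->
  (forall i, closed (A0 i)) -> (forall i, closed (A1 i)) ->
  (forall i x y, A0 i x -> A1 i y -> eps <= dist x y) ->
  (forall M (v : {ffun 'I_n -> 'I_M.+1}) i, v i = 0%N :> nat -> A0 i (g M v)) ->
  (forall M (v : {ffun 'I_n -> 'I_M.+1}) i,
     (0 < M)%N -> v i = M :> nat -> A1 i (g M v)) ->
  (forall e : R, 0 < e -> exists2 M, (0 < M)%N &
     forall v u : {ffun 'I_n -> 'I_M.+1},
       (forall i, (v i <= u i <= (v i).+1)%N) -> ball (g M v) e (g M u)) ->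
  ((n%:R : R)%:E <= Widim dist eps)%E.
Proof.
move=> cX cA0 cA1 sep gA0 gA1 gc; apply/ereal_infP => _ [k [K [f [cK cf ef Kk]]] <-].
rewrite lee_fin ler_nat; apply: (covdim_cube cX cK cf cA0 cA1 _ gA0 gA1 gc Kk).
move=> i x y xA yA /ef; apply/negP; rewrite -leNgt; exact: sep xA yA.
Qed.

Section CubeInPatternSpace.
Context (R : realType) (S : countType) (F : seq S -> Prop) (n : nat) (a : 'I_n -> S).
Local Notation X := (pattern_space R F).
Hypothesis a_inj : injective a.
Hypothesis aF : forall E, uniq E -> (forall s, s \in E -> exists i, s = a i) -> F E.

Definition grid_coord (M : nat) (v : {ffun 'I_n -> 'I_M.+1}) (s : S) : R :=
  if [pick i | a i == s] is Some i then (v i)%:R / M%:R else 0.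

Lemma grid_coord_itv M v s : 0 <= @grid_coord M v s <= 1.
Proof.
rewrite /grid_coord; case: pickP => [i _|_]; last by rewrite lexx ler01.
rewrite divr_ge0//=; have : (v i <= M)%N by rewrite -ltnS.
have [M0|M0] := posnP M; first by rewrite [X in X%:R^-1]M0 invr0 mulr0 ler01.
by rewrite ler_pdivrMr ?ltr0n// mul1r ler_nat.
Qed.

Lemma grid_coord_supp M v E : uniq E ->
  (forall s, s \in E -> @grid_coord M v s != 0) -> F E.
Proof.
move=> uE vE; apply: aF => // s /vE; rewrite /grid_coord.
by case: pickP => [i /eqP <- _|_]; [exists i|rewrite eqxx].
Qed.

Definition grid_pt M v : X :=
  PatternPoint (@grid_coord_itv M v) (@grid_coord_supp M v).

Lemma grid_ptE M v i : @grid_pt M v (a i) = (v i)%:R / M%:R.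
Proof.
rewrite /= /grid_coord; case: pickP => [j /eqP/a_inj -> //|/(_ i)].
by rewrite eqxx.
Qed.

Lemma closed_coord (s : S) (c : R) : closed [set x : X | x s = c].
Proof.
have -> : [set x : X | x s = c] = (fun x : X => x s) @^-1` [set c] by [].
by apply: preimage_closed => [x _|]; [exact: continuous_pt|exact: closed_eq].
Qed.

Lemma Widim_ge_pattern (dist : X -> X -> R) (eps : R) :
  (forall i (x y : X), x (a i) = 0 -> y (a i) = 1 -> eps <= dist x y) ->
  ((n%:R : R)%:E <= Widim dist eps)%E.
Proof.
move=> sep; apply: (@Widim_ge_cube _ _ _ _ _ (fun i => [set x : X | x (a i) = 0])
   (fun i => [set x : X | x (a i) = 1]) grid_pt) => //.
- exact: pattern_space_compact.
- by move=> i; exact: closed_coord.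
- by move=> i; exact: closed_coord.
- by move=> M v i vi; rewrite /mkset grid_ptE vi mul0r.
- by move=> M v i M0 vi; rewrite /mkset grid_ptE vi divff// pnatr_eq0 -lt0n.
- move=> e e0; exists (Num.truncn e^-1).+1 => // v u vu.
  rewrite pt_ballE => s /=; rewrite /grid_coord.
  case: pickP => [i _|_]; last by rewrite subrr normr0 mulr_gt0.
  apply: (@lt_le_trans _ _ e); last by rewrite ler_peMr ?ler1n// ltW.
  rewrite -mulrBl normrM normfV normr_nat ltr_pdivrMr ?ltr0n//.
  have [h1 h2] := andP (vu i); apply: (@le_lt_trans _ _ 1).
    move: h1 h2; rewrite -(ler_nat R) -[(_ <= _.+1)%N](ler_nat R) -natr1 ler_norml.
    by lra.
  by rewrite -ltr_pdivrMl// mulr1; exact: truncnS_gt.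
Qed.

End CubeInPatternSpace.

(** * The dynamical system *)

Section CompatibleMetric.
Context (R : realType) (X : pseudoMetricType R) (d : X -> X -> R).
Hypotheses (cX : compact [set: X]) (cd : compatible_metric d).

(** On a compact space a compatible metric is uniformly equivalent to the given balls;
    [ball_compatible] is the other half. *)
Lemma compatible_ball (e : R) : 0 < e ->
  exists2 t : R, 0 < t & forall x y, d x y < t -> ball x e y.
Proof.
move=> e0; have e2 : 0 < e / 2 by rewrite divr_gt0.
case: cd => _ [_ [_ [dT nd]]].
apply: (@uniform_radius _ _ (fun t x => forall y, d x y < t -> ball x e y)) => // x.
have [t t0 xt] := (nd x (ball x (e / 2))).1 (nbhsx_ballx _ _ e2).
exists [set y | d x y < t / 2]; first by apply/nd; exists (t / 2); rewrite ?divr_gt0.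
exists (t / 2); rewrite ?divr_gt0// => y u /= xy u0 ut z yz.
rewrite [e]splitr; apply: (@ball_triangle _ _ x).
  by apply/ball_sym/xt => /=; lra.
by apply: xt => /=; have := dT x y z; lra.
Qed.

Lemma ball_compatible (e : R) : 0 < e ->
  exists2 t : R, 0 < t & forall x y, ball x t y -> d x y < e.
Proof.
move=> e0; case: cd => _ [_ [dC [dT nd]]].
apply: (@uniform_radius _ _ (fun t x => forall y, ball x t y -> d x y < e)) => // x.
have /nbhs_ballP[t /= t0 xt] : nbhs x [set y | d x y < e / 2].
  by apply/nd; exists (e / 2); rewrite ?divr_gt0.
exists (ball x (t / 2)); first by apply: nbhsx_ballx; rewrite divr_gt0.
exists (t / 2); rewrite ?divr_gt0// => y u xy u0 ut z yz.
have h1 : d x z < e / 2.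
  apply: xt; rewrite [t]splitr; apply: ball_triangle xy _.
  by apply: le_ball yz; exact: ltW.
have h2 : d x y < e / 2 by apply: xt; apply: le_ball xy; lra.
by have := dT y x z; rewrite (dC y x); lra.
Qed.

End CompatibleMetric.

(* The coordinates of a site are its column, its height and its layer. *)
Notation site := ((int * int) * nat)%type.

Definition shift_site (n : int * int) (s : site) : site :=
  ((s.1.1 + n.1, s.1.2 + n.2), s.2).

(** The offset [b] may depend on the finite set [E], so limits of patterns translated ever farther
    are included. *)
Definition column_pattern (A : int -> nat -> Prop) (E : seq site) : Prop :=
  exists a b : int, forall s, s \in E -> s.1.1 = a /\ A (s.1.2 - b) s.2.

Section System.
Context (R : realType) (A : int -> nat -> Prop).
Local Notation X := (pattern_space R (column_pattern A)).

Lemma shift_inj n : injective (shift_site n).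
Proof. by move=> [[a b] l] [[a' b'] l'] [] /addIr -> /addIr -> ->. Qed.

Lemma translate_itv n (x : X) s : 0 <= x (shift_site n s) <= 1.
Proof. exact: pt_itv. Qed.

Lemma translate_supp n (x : X) E : uniq E ->
  (forall s, s \in E -> x (shift_site n s) != 0) -> column_pattern A E.
Proof.
move=> uE xE; have [|t|a [b H]] := @pt_supp _ _ _ x (map (shift_site n) E).
- by rewrite map_inj_uniq//; exact: shift_inj.
- by move=> /mapP[s sE ->]; exact: xE.
exists (a - n.1), (b - n.2) => s sE; have [<- h] := H _ (map_f _ sE).
split; first by rewrite addrK.
by have -> : s.1.2 - (b - n.2) = s.1.2 + n.2 - b by lia.
Qed.

Definition translate n (x : X) : X :=
  PatternPoint (translate_itv n x) (@translate_supp n x).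

Lemma translate_action : Z2_action translate.
Proof.
split; last split.
- by move=> n; apply: continuous_to_pt => s; exact: continuous_pt.
- by move=> x; apply: pt_ext => -[[a b] l] /=; rewrite /shift_site /= !addr0.
- move=> m n x; apply: pt_ext => -[[a b] l] /=; rewrite /shift_site /=.
  by rewrite -!addrA.
Qed.

Definition box (N : nat) (n : int * int) : Prop :=
  (- N%:Z <= n.1 <= N%:Z) && (- N%:Z <= n.2 <= N%:Z).

Section Truncation.
Variable O : site -> Prop.
Let F' E := column_pattern A E /\ forall s, s \in E -> O s.

Let trunc_coord (x : X) s : R := if `[< O s >] then x s else 0.

Let trunc_itv x s : 0 <= trunc_coord x s <= 1.
Proof. by rewrite /trunc_coord; case: ifP => _; [exact: pt_itv|rewrite lexx ler01]. Qed.

Let trunc_supp x E : uniq E -> (forall s, s \in E -> trunc_coord x s != 0) -> F' E.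
Proof.
move=> uE xE; split; last first.
  by move=> s /xE; rewrite /trunc_coord; case: asboolP => //; rewrite eqxx.
apply: (@pt_supp _ _ _ x) => // s /xE; rewrite /trunc_coord.
by case: ifP => //; rewrite eqxx.
Qed.

(** The target is again a pattern space, so the general lemmas give its compactness and
    dimension. *)
Definition truncation x : pattern_space R F' :=
  PatternPoint (trunc_itv x) (@trunc_supp x).

Lemma truncation_continuous : continuous truncation.
Proof.
apply: continuous_to_pt => s.
have -> : (fun x => truncation x s) = if `[< O s >] then (fun x : X => x s) else cst 0.
  by apply/funext => x; rewrite /= /trunc_coord; case: ifP.
case: ifP => _; first exact: continuous_pt.
exact: cst_continuous.
Qed.

Lemma truncation_eq x y s : O s -> truncation x = truncation y -> x s = y s.
Proof. by move=> Os /(congr1 (fun z => pt z s)) /=; rewrite /trunc_coord asboolT. Qed.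

End Truncation.

(** * Bounds on Widim by counting sites *)

Section Metric.
Variables (d : X -> X -> R).
Hypothesis cd : compatible_metric d.

(** Points that agree on the translates of a finite window [B] are [eps]-close, so truncation to
    these sites is an [eps]-embedding into a union of cubes of dimension at most [k]. The window
    depends on [eps] but not on [P] and [N]. *)
Lemma Widim_le_window (eps : R) : 0 < eps -> exists B : seq site,
  forall (P : set (int * int)) (N k : nat),
  (forall E, uniq E -> column_pattern A E ->
     (forall s, s \in E ->
       exists n b, [/\ P n, box N n, b \in B & s = shift_site n b]) ->
     (size E <= k)%N) ->
  (Widim (dT d translate P N) eps <= (k%:R : R)%:E)%E.
Proof.
move=> eps0; have [t t0 Ht] := ball_compatible (@pattern_space_compact _ _ _) cd eps0.
have [B HB] := ball_window (column_pattern A) t0.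
exists B => P N k Hk; apply: ereal_inf_lbound; exists k => //.
pose O s := exists n b, [/\ P n, box N n, b \in B & s = shift_site n b].
exists (pattern_space R (fun E => column_pattern A E /\ forall s, s \in E -> O s)),
  (truncation O); split.
- by split; [exact: pattern_space_hausdorff|exact: pattern_space_compact].
- exact: truncation_continuous.
- move=> x x' xx'; rewrite /dT.
  apply/bigmax_ltP; split => // i _; apply/bigmax_ltP; split => // j _.
  case: asboolP => // Pn; apply: Ht; apply: HB => s sB /=.
  rewrite (@truncation_eq O _ _ _ _ xx') ?subrr ?normr0//.
  eexists; exists s; split; [exact: Pn| |by []|by []].
  by rewrite /box /=; have := ltn_ord i; have := ltn_ord j; lia.
- pose W := [seq ((i%:Z - N%:Z)%R, (j%:Z - N%:Z)%R) |
    i <- iota 0 (N + N).+1, j <- iota 0 (N + N).+1].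
  apply: (@covdim_cube_union _ _ _ [seq shift_site n b | n <- W, b <- B]).
  move=> E uE [EA EO].
  split; last exact: Hk.
  move=> s /EO[n [b [_ nN bB ->]]]; apply/allpairsP; exists (n, b); split => //=.
  move: nN; rewrite /box => /andP[n1 n2].
  apply/allpairsP; exists (absz (n.1 + N%:Z), absz (n.2 + N%:Z)).
  split; [rewrite mem_iota /=; lia|rewrite mem_iota /=; lia|].
  by rewrite [LHS]surjective_pairing /=; congr pair; lia.
Qed.

Lemma le_dT (P : set (int * int)) N n x y : P n -> box N n ->
  d (translate n x) (translate n y) <= dT d translate P N x y.
Proof.
move=> Pn /andP[n1 n2].
have i1 : (absz (n.1 + N%:Z)%R < (N + N).+1)%N by lia.
have i2 : (absz (n.2 + N%:Z)%R < (N + N).+1)%N by lia.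
rewrite /dT; apply: (bigmax_sup (Ordinal i1)) => //.
apply: (bigmax_sup (Ordinal i2)) => //=.
have -> : ((absz (n.1 + N%:Z))%:Z - N%:Z, (absz (n.2 + N%:Z))%:Z - N%:Z) = n.
  by rewrite [RHS]surjective_pairing /=; congr pair; lia.
by rewrite asboolT.
Qed.

(** The translation by [s.1] brings a site [s] to the origin in its layer. A difference of 1 there
    forces a distance bounded below in terms of [L] only, which separates opposite faces of the cube
    on [B]. *)
Lemma Widim_ge_sites (L : nat) : exists2 eps0 : R, 0 < eps0 &
  forall (P : set (int * int)) (N : nat) (B : seq site) (eps : R), eps <= eps0 ->
  uniq B -> (forall s, s \in B -> [/\ P s.1, box N s.1 & (s.2 < L)%N]) ->
  (forall E, uniq E -> {subset E <= B} -> column_pattern A E) ->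
  (((size B)%:R : R)%:E <= Widim (dT d translate P N) eps)%E.
Proof.
have [m m_gt0 Hm] : exists2 m : nat, (0 < m)%N & forall l : nat, (l < L)%N ->
    ((pickle ((0%Z, 0%Z, l) : site)).+1 <= m)%N.
  pose p (l : nat) := (pickle ((0%Z, 0%Z, l) : site)).+1.
  exists (\max_(l < L) p l).+1 => // l lL; apply: leqW.
  exact: (leq_bigmax (F := fun l : 'I_L => p l) (Ordinal lL)).
have m0 : 0 < m%:R^-1 :> R by rewrite invr_gt0 ltr0n.
have [t t0 Ht] := compatible_ball (@pattern_space_compact _ _ _) cd m0.
exists t => // P N B eps epst uB BP BA.
pose a (i : 'I_(size B)) := tnth (in_tuple B) i.
have aB i : a i \in B by exact: mem_tnth.
apply: (@Widim_ge_pattern _ _ _ _ a).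
- by move=> i j /(tuple_uniqP (in_tuple B) uB).
- by move=> E uE aE; apply: BA => // s /aE[i ->].
move=> i x y xi yi; apply: (le_trans epst).
have [Pi Ni iL] := BP _ (aB i); apply: le_trans (le_dT _ _ Pi Ni).
rewrite leNgt; apply/negP => /Ht; rewrite pt_ballE.
move: (Hm _ iL) => + /(_ ((0%Z, 0%Z, (a i).2) : site)).
move: (pickle _).+1 => p pm /=.
have -> : shift_site (a i).1 (0%Z, 0%Z, (a i).2) = a i.
  by case: (a i) => -[u v] l; rewrite /shift_site /= !add0r.
rewrite xi yi sub0r normrN1 ltNge => /negP; apply.
by rewrite mulrC ler_pdivrMr ?ltr0n// mul1r ler_nat.
Qed.

End Metric.
End System.

(** * Beatty sequences and linear bounds on Widim *)

Definition beatty (R : realType) (s : R) (h : int) : nat :=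
  absz (Num.floor ((h + 1)%:~R * s) - Num.floor (h%:~R * s)).

(** The sum telescopes: for [s >= 0] the floors increase, so [absz] changes nothing. *)
Lemma sum_beatty (R : realType) (s : R) (h : int) (n : nat) : 0 <= s ->
  Posz (\sum_(i < n) beatty s (h + i%:Z))%N =
  Num.floor ((h + n%:Z)%:~R * s) - Num.floor (h%:~R * s).
Proof.
move=> s0; elim: n => [|n IH]; first by rewrite big_ord0 addr0 subrr.
rewrite big_ord_recr PoszD IH /= /beatty.
have : Num.floor ((h + n%:Z)%:~R * s) <= Num.floor ((h + n%:Z + 1)%:~R * s).
  by apply: le_floor; rewrite ler_wpM2r// ler_int lerDl.
have -> : h + n.+1%:Z = h + n%:Z + 1 by lia.
lia.
Qed.

Lemma sum_beatty_bounds (R : realType) (s : R) (h : int) (n : nat) : 0 <= s ->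
  n%:R * s - 1 <= (\sum_(i < n) beatty s (h + i%:Z))%N%:R <= n%:R * s + 1.
Proof.
move=> s0; have := sum_beatty h n s0; set k := (\sum_(i < n) _)%N.
move=> /(congr1 (fun z => z%:~R : R)).
rewrite intrB -[(Posz k)%:~R]/(k%:R) => ->.
have := floor_itv ((h + n%:Z)%:~R * s); have := floor_itv (h%:~R * s).
rewrite !intrD mulrDl -[(Posz n)%:~R]/(n%:R); lra.
Qed.

Definition strip (a b h : int) (n : nat) (c : int -> nat) : seq site :=
  [seq ((a, h + i%:Z + b), l) | i <- iota 0 n, l <- iota 0 (c (h + i%:Z))].

Lemma size_strip a b h n c : size (strip a b h n c) = (\sum_(i < n) c (h + i%:Z)%R)%N.
Proof.
rewrite size_allpairs_dep sumnE big_map -[in LHS](subn0 n) -/(index_iota 0 n).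
rewrite big_mkord.
by apply: eq_bigr => i _; rewrite size_iota.
Qed.

Lemma mem_strip (a b h : int) n (c : int -> nat) (s : site) :
  s.1.1 = a -> h <= s.1.2 - b < h + n%:Z ->
  (s.2 < c (s.1.2 - b)%R)%N -> s \in strip a b h n c.
Proof.
move=> sa sh sc; apply/allpairsPdep; exists (absz (s.1.2 - b - h)%R), s.2.
have e : h + (absz (s.1.2 - b - h)%R)%:Z = s.1.2 - b by lia.
rewrite e mem_iota /= add0n; split; [lia|by rewrite mem_iota|].
by case: s sa {sh sc e} => -[u v] l /= ->; congr (_, _, _); lia.
Qed.

Lemma strip_mem (a b h : int) n (c : int -> nat) (s : site) :
  s \in strip a b h n c ->
  [/\ s.1.1 = a, h <= s.1.2 - b < h + n%:Z & (s.2 < c (s.1.2 - b)%R)%N].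
Proof.
move=> /allpairsPdep[i [l [+ + ->]]]; rewrite !mem_iota !add0n /= => i_n lc.
by rewrite addrK; split => //; lia.
Qed.

Lemma strip_uniq a b h n c : uniq (strip a b h n c).
Proof.
apply: allpairs_uniq_dep; rewrite ?iota_uniq//; first by move=> i _; exact: iota_uniq.
by move=> [i l] [i' l'] _ _ /= [] /addIr/addrI[-> ->].
Qed.

Section Bounds.
Context (R : realType) (A : int -> nat -> Prop).
Local Notation X := (pattern_space R (column_pattern A)).
Variables (d : X -> X -> R).
Hypothesis cd : compatible_metric d.

(** An inclusion of patterns suffices for a lower bound; this covers finite [rho], and infinite
    [rho] through every finite slope. *)
Lemma Widim_ge_beatty (s : R) : 0 <= s ->
  (forall h l, (l < beatty s h)%N -> A h l) ->
  exists2 eps0 : R, 0 < eps0 & forall (P : set (int * int)) N eps, eps <= eps0 ->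
    (forall h : int, P (0, h)) ->
    (((N + N)%:R * s - 1)%:E <= Widim (dT d (@translate R A) P N) eps)%E.
Proof.
move=> s0 sA; pose L := (Num.truncn (s + 1)).+1.
have [eps0 eps00 H] := Widim_ge_sites cd L; exists eps0 => // P N eps epsle P0.
apply: (@le_trans _ _ ((size (strip 0 0 (- N%:Z) (N + N) (beatty s)))%:R%:E)).
  by rewrite size_strip lee_fin; case/andP: (sum_beatty_bounds (- N%:Z) (N + N) s0).
apply: H => //; first exact: strip_uniq.
- move=> [[a h] l] /strip_mem /= [-> hN lh]; split; [exact: P0| |].
    by rewrite /box /=; lia.
  (* Each height carries at most s + 1 sites, fewer than [L]. *)
  apply: (leq_trans lh); rewrite -(ler_nat R); apply/ltW.
  apply: le_lt_trans (truncnS_gt _).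
  by have := sum_beatty_bounds (h - 0) 1 s0; rewrite big_ord1 addr0 mul1r => /andP[].
- move=> E uE EB; exists 0, 0 => t /EB/strip_mem[-> _ lh]; split => //.
  exact: sA.
Qed.

Lemma Widim_le_beatty (s eps : R) : 0 <= s -> 0 < eps ->
  (forall h l, A h l -> (l < beatty s h)%N) ->
  exists C : R, forall (P : set (int * int)) N,
    (Widim (dT d (@translate R A) P N) eps <= ((N + N)%:R * s + C)%:E)%E.
Proof.
move=> s0 eps0 As; have [B HB] := Widim_le_window cd eps0.
have [m mB] : exists m : nat, forall b, b \in B -> (absz b.1.2 <= m)%N.
  exists (\sum_(b <- B) absz b.1.2)%N => b bB.
  by rewrite (big_rem _ bB) /= leq_addr.
(* The heights met lie among 2N + 2m + 1 consecutive integers, which carry at most that number times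
   [s], plus 1, sites of the pattern. *)
exists ((m + m).+1%:R * s + 1) => P N.
pose x : R := ((N + N) + (m + m).+1)%:R * s + 1.
have x0 : 0 <= x by rewrite addr_ge0// mulr_ge0.
apply: (@le_trans _ _ ((Num.truncn x)%:R%:E)); last first.
  rewrite lee_fin (_ : _ + _ = x); last by rewrite /x natrD; ring.
  by case/andP: (truncn_itv x0).
apply: HB => E uE [a [b0 HE]] EW.
suff : (size E <= size (strip a b0 (- (N%:Z + m%:Z + b0))
    ((N + N) + (m + m).+1) (beatty s)))%N.
  move/leq_trans; apply; rewrite size_strip leqNgt; apply/negP => h.
  have := truncnS_gt x; apply/negP; rewrite -leNgt.
  have /andP[_] := sum_beatty_bounds (- (N%:Z + m%:Z + b0)) (N + N + (m + m).+1) s0.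
  by apply: le_trans; rewrite ler_nat.
apply: uniq_leq_size => // t tE; have [ta tA] := HE t tE.
apply: mem_strip => //; last exact: As.
have [n [b [_ nN /mB bm tn]]] := EW t tE.
move: nN bm; rewrite tn /box /= => /andP[_ /andP[n1 n2]] bm. lia.
Qed.

(** Near the line the product of a site with [v] is bounded. In a fixed column, as [v.2] is nonzero,
    this confines the height to an interval of bounded length; the window bounds the layer. *)
Lemma Widim_le_transverse (v : R * R) (r eps : R) : 0 < eps ->
  unit_circle v -> v.2 != 0 -> exists C : R, forall N,
    (Widim (dT d (@translate R A) (Br r (perp_line v)) N) eps <= C%:E)%E.
Proof.
move=> eps0 v1 v20; have [B HB] := Widim_le_window cd eps0.
have [m mB] : exists m : nat, forall b, b \in B ->
    (absz b.1.1 + absz b.1.2 + b.2 <= m)%N.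
  exists (\sum_(b <- B) (absz b.1.1 + absz b.1.2 + b.2))%N => b bB.
  by rewrite (big_rem _ bB) /= leq_addr.
(* Each coordinate contributes at most [r] from the strip and [m] from the window. In [K], the extra
   1 makes up for the floor in [h0]. *)
pose D := (2 * r + 2 * m%:R) / `|v.2|.
pose K := (Num.truncn (2 * D + 1)).+1.
exists ((K * m.+1)%N%:R) => N; apply: HB => E uE [a [b0 HE]] EW.
(* [y] is the height at which the line crosses column [a]. *)
pose y := - (a%:~R * v.1) / v.2; pose h0 := Num.floor (y - D).
suff : (size E <= size (strip a 0 h0 K (fun=> m.+1)))%N.
  by rewrite size_strip sum_nat_const card_ord.
apply: uniq_leq_size => // t tE; have [ta _] := HE t tE.
have [n [b [[w Vw wr] _ /mB bm tn]]] := EW t tE.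
apply: mem_strip => //; last by rewrite tn ltnS; apply: leq_trans bm; exact: leq_addl.
have sq_lt (p q : R) : Num.sqrt (p ^+ 2 + q ^+ 2) < r -> `|p| < r.
  by apply: le_lt_trans; rewrite -sqrtr_sqr ler_wsqrtr// lerDl sqr_ge0.
have w1r : `|n.1%:~R - w.1| < r by exact: sq_lt wr.
have w2r : `|n.2%:~R - w.2| < r by apply: (sq_lt _ (n.1%:~R - w.1)); rewrite addrC.
have v1le : `|v.1| <= 1.
  rewrite -[leRHS]sqrtr1 -sqrtr_sqr ler_wsqrtr// -v1.
  by rewrite lerDl sqr_ge0.
have v2le : `|v.2| <= 1.
  rewrite -[leRHS]sqrtr1 -sqrtr_sqr ler_wsqrtr// -v1.
  by rewrite lerDr sqr_ge0.
have b1m : `|b.1.1%:~R : R| <= m%:R.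
  by rewrite -intr_norm -natr_absz ler_nat (leq_trans _ bm)// -addnA leq_addr.
have b2m : `|b.1.2%:~R : R| <= m%:R.
  rewrite -intr_norm -natr_absz ler_nat (leq_trans _ bm)//.
  by rewrite (leq_trans (leq_addl _ _) (leq_addr _ _)).
have mulle (p q e : R) : `|p| <= e -> `|q| <= 1 -> `|p * q| <= e.
  by move=> pe q1; rewrite normrM -[leRHS]mulr1 ler_pM.
have E0 : a%:~R * v.1 + t.1.2%:~R * v.2 = (n.1%:~R - w.1) * v.1 +
    (n.2%:~R - w.2) * v.2 + (b.1.1%:~R * v.1 + b.1.2%:~R * v.2).
  rewrite -ta tn /= !intrD; move: Vw; rewrite /perp_line /mkset => Vw.
  by apply/eqP; rewrite -subr_eq0; apply/eqP; rewrite -[RHS]Vw; ring.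
have zy : `|t.1.2%:~R - y| <= D.
  have -> : t.1.2%:~R - y = (a%:~R * v.1 + t.1.2%:~R * v.2) / v.2 by rewrite /y; field.
  rewrite normrM normfV /D ler_wpM2r ?invr_ge0// E0.
  have := mulle _ _ _ (ltW w1r) v1le; have := mulle _ _ _ (ltW w2r) v2le.
  have := mulle _ _ _ b1m v1le; have := mulle _ _ _ b2m v2le.
  by rewrite !ler_norml; lra.
have := floor_itv (y - D); rewrite -/h0 intrD => h0y.
have := truncnS_gt (2 * D + 1); rewrite -/K => KD.
move: zy; rewrite ler_distl => zy.
rewrite subr0; apply/andP; split; first by rewrite -ltzD1 -(ltr_int R) intrD; lra.
by rewrite -(ltr_int R) intrD -[(Posz K)%:~R]/(K%:R); lra.
Qed.

End Bounds.

(** * Directional mean dimension *)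

Lemma le_limn_einf (R : realType) (u v : (\bar R)^nat) :
  (forall n, u n <= v n)%E -> (limn_einf u <= limn_einf v)%E.
Proof.
move=> uv; rewrite !limn_einf_lim; apply: lee_lim; try exact: is_cvg_einfs.
apply: nearW => n; apply/ereal_infP => _ [k /= nk <-].
by apply: le_trans (uv k); apply: ereal_inf_lbound; exists k.
Qed.

Lemma limn_einf_affine (R : realType) (s C mu : R) : 0 < mu ->
  limn_einf (fun N : nat =>
    (((N + N)%:R * s + C)%:E * (((N + N)%:R / mu)^-1)%:E)%E) = (s * mu)%:E.
Proof.
move=> mu0; apply: (cvg_limn_einf_sup _).1.
have L : (fun n => s * mu + C * mu / 2 * harmonic n) @ \oo --> s * mu.
  rewrite -[X in _ --> X]addr0 -[X in _ --> _ + X](mulr0 (C * mu / 2)).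
  by apply: cvgD; [exact: cvg_cst|apply: cvgM; [exact: cvg_cst|exact: cvg_harmonic]].
apply: (@cvg_comp _ _ _
  (fun N : nat => ((N + N)%:R * s + C) * ((N + N)%:R / mu)^-1) EFin
  \oo (nbhs (s * mu))); last by [].
(* The shift skips N = 0, where the denominator vanishes; from then on the quotient is s mu + C mu /
   (2N). *)
rewrite -cvg_shiftS /=; apply: cvg_trans L; apply: near_eq_cvg; apply: nearW => n.
rewrite /harmonic /= natrD; have k0 : n.+1%:R != 0 :> R by rewrite pnatr_eq0.
by field; rewrite nat1r -natrD !pnatr_eq0 gt_eqF.
Qed.

Lemma limn_einf_ratio_le (R : realType) (W : (\bar R)^nat) (s C mu : R) : 0 < mu ->
  (forall N, W N <= ((N + N)%:R * s + C)%:E)%E ->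
  (limn_einf (fun N => W N * (((N + N)%:R / mu)^-1)%:E) <= (s * mu)%:E)%E.
Proof.
move=> mu0 WC; rewrite -(limn_einf_affine s C mu0); apply: le_limn_einf => N.
by rewrite lee_wpmul2r// lee_fin invr_ge0 divr_ge0// ltW.
Qed.

Lemma limn_einf_ratio_ge (R : realType) (W : (\bar R)^nat) (s C mu : R) : 0 < mu ->
  (forall N, ((N + N)%:R * s + C)%:E <= W N)%E ->
  ((s * mu)%:E <= limn_einf (fun N => W N * (((N + N)%:R / mu)^-1)%:E))%E.
Proof.
move=> mu0 WC; rewrite -(limn_einf_affine s C mu0); apply: le_limn_einf => N.
by rewrite lee_wpmul2r// lee_fin invr_ge0 divr_ge0// ltW.
Qed.

Lemma max_norm_gt0 (R : realType) (v : R * R) : unit_circle v ->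
  0 < Num.max `|v.1| `|v.2|.
Proof.
rewrite /unit_circle /mkset => v1; rewrite lt_max !normr_gt0.
apply/orP; have [v0|] := eqVneq v.1 0; last by left.
right; apply/eqP => v20; move: v1; rewrite v0 v20 expr0n addr0 => /eqP.
by rewrite eq_sym oner_eq0.
Qed.

Lemma vol_perpE (R : realType) (v : R * R) (N : nat) : unit_circle v ->
  fine (vol_perp v N) = (N + N)%:R / Num.max `|v.1| `|v.2|.
Proof.
move=> v1; have := max_norm_gt0 v1; set mu := Num.max _ _ => mu0.
rewrite /vol_perp (_ : [set t | _] = [set` `[- (N%:R / mu), N%:R / mu]]).
  rewrite lebesgue_measure_itv /= lte_fin; case: ifPn => h.
    by rewrite /= natrD opprK mulrDl.
  have -> : N = 0%N.
    case: (posnP N) => // N0; move: h; rewrite -leNgt.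
    have : 0 < N%:R / mu by rewrite divr_gt0 ?ltr0n.
    by move=> h1 h2; exfalso; lra.
  by rewrite mul0r.
apply/seteqP; split => t /=; rewrite in_itv /= -ler_norml ler_pdivlMr// !normrM.
  by move=> [h1 h2]; rewrite /mu maxEle; case: ifP.
move=> h; split; apply: le_trans h; apply: ler_wpM2l => //.
  by rewrite /mu le_max lexx orbT.
by rewrite /mu le_max lexx.
Qed.

Lemma Widim_ge0 (R : realType) (X : pseudoMetricType R) (dist : X -> X -> R) eps :
  (0 <= Widim dist eps)%E.
Proof. by apply/ereal_infP => _ [n _ <-]; rewrite lee_fin. Qed.

(** The last case is meant for [+oo]: every layer is allowed at every height. *)
Definition rotation_pattern (R : realType) (rho : \bar R) (h : int) (l : nat) :
    Prop :=
  match rho with r%:E => (l < beatty r h)%N | _ => True end%E.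

Section Mdim.
Context (R : realType) (rho : \bar R).
Hypothesis rho0 : (0 <= rho)%E.
Local Notation A := (rotation_pattern rho).
Local Notation X := (pattern_space R (column_pattern A)).
Variables (d : X -> X -> R) (r : R).
Hypothesis cd : compatible_metric d.
Hypothesis r0 : 0 < r.

(** For fixed [eps] the numerator is bounded in [N], while the volume grows linearly. *)
Lemma mdim_transverse (v : R * R) : unit_circle v -> v.2 != 0 ->
  mdim_perp d (@translate R A) r v = 0%E.
Proof.
move=> v1 v2; apply: lim_near_cst => //; near=> eps.
have eps0 : 0 < eps by near: eps; exact: nbhs_right_gt.
have mu0 := max_norm_gt0 v1.
under eq_fun do rewrite vol_perpE//.
have [C HC] := Widim_le_transverse cd r eps0 v1 v2.
have -> : 0%E = (0 * Num.max `|v.1| `|v.2|)%:E by rewrite mul0r.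
apply/le_anti/andP; split.
  by apply: (@limn_einf_ratio_le _ _ _ C) => // N; rewrite mulr0 add0r.
apply: (@limn_einf_ratio_ge _ _ _ 0) => // N; rewrite mulr0 add0r.
exact: Widim_ge0.
Unshelve. all: by end_near.
Qed.

Lemma mdim_vertical (v : R * R) : v = (-1, 0) \/ v = (1, 0) ->
  mdim_perp d (@translate R A) r v = rho.
Proof.
move=> vE; have v1 : unit_circle v.
  by case: vE => ->; rewrite /unit_circle /mkset /= expr0n ?sqrrN expr1n addr0.
have mu1 : Num.max `|v.1| `|v.2| = 1.
  by case: vE => -> /=; rewrite ?normrN normr1 normr0 max_l.
have Pv h : Br r (perp_line v) (0, h).
  exists (0, h%:~R).
    by case: vE => ->; rewrite /perp_line /mkset /= mul0r mulr0 addr0.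
  by rewrite /= !subrr expr0n addr0 sqrtr0.
rewrite /mdim_perp; under eq_fun => eps do under eq_fun => N do rewrite vol_perpE// mu1.
have ge s : 0 <= s -> (forall h l, (l < beatty s h)%N -> A h l) ->
    \forall eps \near 0^'+, (s%:E <= limn_einf (fun N : nat =>
      (Widim (dT d (@translate R A) (Br r (perp_line v)) N) eps *
        ((N + N)%:R / 1)^-1%:E)))%E.
  move=> s0 sA; have [e0 e00 H] := Widim_ge_beatty cd s0 sA.
  near=> eps; rewrite -[s]mulr1; apply: (@limn_einf_ratio_ge _ _ _ (-1)) => // N.
  apply: H => //; apply/ltW; near: eps; exact: nbhs_right_lt.
have [[s E]|[E|E]] : (exists s, rho = s%:E) \/ rho = +oo%E \/ rho = -oo%E.
    by case: rho => [s| |]; [left; exists s|right; left|right; right].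
- have s0 : 0 <= s by move: rho0; rewrite E lee_fin.
  (* Upper and lower bounds share the slope [s], so the lower limit is [s] for every small [eps]. *)
  apply: etrans (esym E); apply: lim_near_cst => //.
  have sA (h : int) l : (l < beatty s h)%N -> A h l by rewrite /rotation_pattern E.
  have As (h : int) l : A h l -> (l < beatty s h)%N by rewrite /rotation_pattern E.
  apply: filterS2 (nbhs_right_gt 0) (ge _ s0 sA) => eps eps0 ges.
  apply/le_anti/andP; split => //.
  have [C HC] := Widim_le_beatty cd s0 eps0 As.
  by rewrite -[s]mulr1; exact: (@limn_einf_ratio_le _ _ _ C).
- apply: etrans (esym E); apply: cvg_lim => //; apply/cvgeyPge => M.
  (* Every nonnegative slope is available here; the maximum with 0 ensures the sign. *)
  have M0 : 0 <= Num.max M 0 by rewrite le_max lexx orbT.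
  have sA (h : int) l : (l < beatty (Num.max M 0)%R h)%N -> A h l.
    by rewrite /rotation_pattern E.
  apply: filterS (ge _ M0 sA) => eps; apply: le_trans.
  by rewrite lee_fin le_max lexx.
- by have : (0 <= -oo :> \bar R)%E by rewrite -E.
Unshelve. all: by end_near.
Qed.

Lemma mdim_discontinuous : (0 < rho)%E ->
  ~ {within (@unit_circle R), continuous (mdim_perp d (@translate R A) r)}.
Proof.
move=> rho_gt0 /subspace_continuousP/(_ (1, 0)) H.
have v1 : @unit_circle R (1, 0) by rewrite /unit_circle /mkset /= expr0n expr1n addr0.
have H1 : mdim_perp d (@translate R A) r x
  @[x --> within (@unit_circle R) (nbhs ((1, 0) : R * R))]
  --> mdim_perp d (@translate R A) r (1, 0) := H v1.
have rhoE : mdim_perp d (@translate R A) r (1, 0) = rho by apply: mdim_vertical; right.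
have /H1/nbhs_ballP[e /= e0 He] :
    nbhs (mdim_perp d (@translate R A) r (1, 0)) [set y | 0 < y]%E.
  by apply: open_nbhs_nbhs; split; [exact: open_ereal_gt_ereal|rewrite /mkset rhoE].
pose t : R := Num.min e 1 / 3.
have t0 : 0 < t by rewrite divr_gt0// lt_min e0 ltr01.
have te : 3 * t <= e by rewrite /t mulrC divfK// ge_min lexx.
have t1 : 3 * t <= 1 by rewrite /t mulrC divfK// ge_min lexx orbT.
have D0 : 0 < 1 + t ^+ 2 by rewrite addr_gt0// exprn_gt0.
(* The rational parametrisation of the circle gives a point within [e] of (1, 0) with nonzero second
   coordinate. The value there is 0, whereas values near [rho] are positive. *)
pose w : R * R := ((1 - t ^+ 2) / (1 + t ^+ 2), 2 * t / (1 + t ^+ 2)).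
have w1 : unit_circle w.
  by rewrite /unit_circle /mkset /=; field; rewrite gt_eqF.
have w2 : w.2 != 0 by rewrite /= mulf_neq0 ?invr_eq0 ?gt_eqF// mulr_gt0.
suff /He/(_ w1) : ball ((1 : R), (0 : R)) e w by rewrite /= mdim_transverse// ltxx.
split => /=; rewrite /ball /= ltr_norml.
  have -> : 1 - (1 - t ^+ 2) / (1 + t ^+ 2) = 2 * t ^+ 2 / (1 + t ^+ 2).
    by field; rewrite gt_eqF.
  have q : 0 <= 2 * t ^+ 2 / (1 + t ^+ 2).
    by apply: divr_ge0; [rewrite mulr_ge0 ?sqr_ge0|exact: ltW].
  by apply/andP; split; [lra|rewrite ltr_pdivrMr//; nra].
have q : 0 < 2 * t / (1 + t ^+ 2) by rewrite divr_gt0// mulr_gt0.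
have q' : 2 * t / (1 + t ^+ 2) < e by rewrite ltr_pdivrMr//; nra.
by apply/andP; split; lra.
Qed.

End Mdim.

Theorem theorem1p1 (R : realType) (rho : \bar R) (hrho : (0 <= rho)%E) :
  exists (X : pseudoMetricType R) (T : int * int -> X -> X),
    [/\ compact_metric_space X, Z2_action T &
      forall (d : X -> X -> R) (r : R),
        compatible_metric d -> Num.sqrt 2 / 2 < r ->
        [/\ (forall v : R * R, v = (-1, 0) \/ v = (1, 0) ->
               mdim_perp d T r v = rho),
            (forall v : R * R, unit_circle v -> v <> (-1, 0) -> v <> (1, 0) ->
               mdim_perp d T r v = 0%E) &
            ((0 < rho)%E ->
               ~ {within (@unit_circle R), continuous (mdim_perp d T r)})]].
Proof.
exists (pattern_space R (column_pattern (rotation_pattern rho))).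
exists (@translate R (rotation_pattern rho)); split.
- by split; [exact: pattern_space_hausdorff|exact: pattern_space_compact].
- exact: translate_action.
move=> d r cd rr; have r0 : 0 < r.
  by apply: le_lt_trans rr; rewrite divr_ge0// sqrtr_ge0.
split; first exact: mdim_vertical.
- move=> v v1 vN vP; apply: mdim_transverse => //; apply/eqP => v2.
  move: v1; rewrite /unit_circle /mkset v2 expr0n addr0 => /eqP.
  rewrite sqrf_eq1 => /orP[] /eqP v1.
    by apply: vP; rewrite [v]surjective_pairing v1 v2.
  by apply: vN; rewrite [v]surjective_pairing v1 v2.
- exact: mdim_discontinuous.
Qed.
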